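(* For every $t\ge 0$, the handover probability at time $t$ is the same in the following two networks. (1) Terrestrial model: static base stations (BSs) in $\mathbb{R}^2$ distributed as a homogeneous Poisson point process (PPP) $\Phi_{\rm B}$ of density $\lambda_0>0$; a reference UE moves along a straight line, in a direction uniformly distributed on $[0,2\pi)$, with constant speed $v$, and is at each time served by its nearest BS. (2) Aerial model: drone base stations (DBSs) in the plane $z=h$ ($h>0$) whose positions at time $0$ form a homogeneous PPP $\Phi_{\rm D}(0)$ of density $\lambda_0$ in that plane; each DBS moves, independently of the other DBSs, along a straight line in a uniformly random direction in that plane with the same constant speed $v$ for all DBSs (same speed model); a static typical UE at the origin $\mathbf{o}=(0,0,0)$ is at each time served by its nearest DBS.
   Context: In either model, let $\mathbf{x}_i(s)$, $i\in\mathbb{N}$, be the positions of the (D)BSs relative to the UE of interest at time $s$ (with an arbitrary fixed indexing of the stations). The handover event by time $t$ is $H(t)=\{\exists s<t:\ \arg\min_{i\in\mathbb{N}}\|\mathbf{x}_i(s)\|\neq \arg\min_{i\in\mathbb{N}}\|\mathbf{x}_i(t)\|\}$, and the handover probability at time $t$ is $\mathbb{P}[H(t)]$, the probability that the first handover (change of the nearest, i.e. serving, station) occurs at or before time $t$. *)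

(* Defs.v *)
From HB Require Import structures.
From mathcomp Require Import all_boot all_order all_algebra.
From mathcomp Require Import all_classical all_reals all_analysis.
Set Implicit Arguments. Unset Strict Implicit. Unset Printing Implicit Defensive.
Import Order.TTheory GRing.Theory Num.Theory.
Local Open Scope classical_set_scope.
Local Open Scope ring_scope.

Section Defs.
Context {R : realType}.

Definition leb2 : set (R * R) -> \bar R :=
  ((@lebesgue_measure R) \x (@lebesgue_measure R))%E.

Definition poisson_mass (mu : R) (k : nat) : R :=
  expR (- mu) * mu ^+ k / (k`!)%:R.

Definition unif_angle (B : set R) : \bar R :=
  (lebesgue_measure (B `&` `[0%R, (2 * pi)%R[) * ((2 * pi)^-1)%:E)%E.

Context {d : measure_display} {T : measurableType d}.

Definition count (x : nat -> T -> R * R) (A : set (R * R)) (w : T) : \bar R :=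
  (\sum_(0 <= i <oo) (\1_A (x i w))%:E)%E.

Definition is_PPP (P : probability T R) (lam : R) (x : nat -> T -> R * R) :=
  (forall i, measurable_fun setT (x i)) /\
  forall (n : nat) (A : nat -> set (R * R)) (k : nat -> nat),
    (forall j, (j < n)%N -> measurable (A j) /\ (leb2 (A j) < +oo)%E) ->
    (forall j j', (j < n)%N -> (j' < n)%N -> j <> j' -> A j `&` A j' = set0) ->
    P [set w | forall j, (j < n)%N -> count x (A j) w = ((k j)%:R)%:E] =
    (\prod_(j < n) poisson_mass (lam * fine (leb2 (A j))) (k j))%:E.

Definition terrestrial_model (P : probability T R) (lam : R)
    (y : nat -> T -> R * R) (th : T -> R) :=
  is_PPP P lam y /\ measurable_fun setT th /\
  forall (m : nat) (C : nat -> set (R * R)) (B : set R),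
    (forall i, measurable (C i)) -> measurable B ->
    P [set w | (forall i, (i < m)%N -> C i (y i w)) /\ B (th w)] =
    (P [set w | forall i, (i < m)%N -> C i (y i w)] * unif_angle B)%E.

Definition aerial_model (P : probability T R) (lam : R)
    (z : nat -> T -> R * R) (ph : nat -> T -> R) :=
  is_PPP P lam z /\ (forall i, measurable_fun setT (ph i)) /\
  forall (m : nat) (C : nat -> set (R * R)) (B : nat -> set R),
    (forall i, measurable (C i)) -> (forall i, measurable (B i)) ->
    P [set w | forall i, (i < m)%N -> C i (z i w) /\ B i (ph i w)] =
    (P [set w | forall i, (i < m)%N -> C i (z i w)] *
       (\prod_(i < m) unif_angle (B i)))%E.

(* distance from the UE to station i at time s, terrestrial model:
   UE at (v s cos th, v s sin th), BS i static at y i. *)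
Definition dist_terr (v : R) (y : nat -> T -> R * R) (th : T -> R)
    (i : nat) (s : R) (w : T) : R :=
  Num.sqrt (((y i w).1 - v * s * cos (th w)) ^+ 2 +
            ((y i w).2 - v * s * sin (th w)) ^+ 2).

(* distance from the UE at the origin to DBS i at time s, aerial model:
   DBS i at ((z i).1 + v s cos(ph i), (z i).2 + v s sin(ph i), h). *)
Definition dist_aer (v h : R) (z : nat -> T -> R * R) (ph : nat -> T -> R)
    (i : nat) (s : R) (w : T) : R :=
  Num.sqrt (((z i w).1 + v * s * cos (ph i w)) ^+ 2 +
            ((z i w).2 + v * s * sin (ph i w)) ^+ 2 + h ^+ 2).

Definition serving (dist : nat -> R -> T -> R) (s : R) (w : T) : set nat :=
  [set i | forall j, dist i s w <= dist j s w].

Definition handover (dist : nat -> R -> T -> R) (t : R) : set T :=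
  [set w | exists s, 0 <= s /\ s < t /\ serving dist s w <> serving dist t w].

End Defs.

(* Main.v *)
Require Import Defs.
From HB Require Import structures.
From mathcomp Require Import all_boot all_order all_algebra.
From mathcomp Require Import all_classical all_reals all_analysis.
From mathcomp Require Import ring lra measurable_realfun.
Import Order.TTheory GRing.Theory Num.Theory.
Import numFieldNormedType.Exports.
Local Open Scope classical_set_scope.
Local Open Scope ring_scope.

(* Let a_i and c_i be the squared horizontal distances from the UE to station i
   at times 0 and t. As all speeds agree, the squared distance at time s is
   (1 - s/t) a_i + (s/t) c_i plus a term that does not depend on i, so no
   handover occurs before t iff the a_i and the c_i have the same minimisers.
   Cut the plane of the pairs (a, c) into square cells of side 1/(n+1). The
   event that both coordinates have their minimal cell index at the same points
   is a countable disjoint union of differences of void events of the point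
   process (a_i, c_i), and since this process is locally finite it agrees with
   the absence of handover for n large. Hence only void probabilities matter.
   In both models the void probability of a bounded L is exp (- lam |D|), with
   |D| the area of {x | (|x|^2, |x + v t u|^2) in L}, which is independent of the
   direction u by rotation invariance of Lebesgue measure. In the terrestrial
   model this follows by conditioning on the direction; in the aerial one by
   integrating out the directions, which leaves the generating functional
   E prod_i (1 - p(z_i)) = exp (- lam \int p) of the Poisson process. *)

Local Notation count := Defs.count.

(** * Invariance of Lebesgue measure under translations and rotations *)

Lemma lebesgue_measure_shift (R : realType) (c : R) (A : set R) : measurable A ->
  lebesgue_measure ((fun x : R => x + c) @^-1` A) = lebesgue_measure A.
Proof.
move=> mA; apply/esym.
have mf : measurable_fun setT ((fun x : R => x + c) : R -> measurableTypeR R).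
  exact: measurable_funD.
apply: (lebesgue_measure_unique (mu := pushforward lebesgue_measure
  ((fun x : R => x + c) : R -> measurableTypeR R))) => //= _ [[a b]] _ <-.
rewrite /pushforward [X in _ = lebesgue_measure X](_ : _ = `]a - c, b - c]%classic).
  by rewrite !lebesgue_measure_itv /= !lte_fin ltrD2r -!EFinB (_ : b - c - (a - c) = b - a) //; ring.
by apply/seteqP; split => x /=; rewrite !in_itv /= ltrBlDr lerBrDr.
Qed.

Section Geometry.
Context {R : realType}.
Implicit Types A : set (R * R).

Definition shear1 (a : R) (x : R * R) : R * R := (x.1 + a * x.2, x.2).
Definition shear2 (a : R) (x : R * R) : R * R := (x.1, x.2 + a * x.1).
Definition rot (c s : R) (x : R * R) : R * R :=
  (c * x.1 - s * x.2, s * x.1 + c * x.2).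

Lemma measurable_shear1 a : measurable_fun setT (shear1 a).
Proof.
apply: measurable_fun_pair => //=; apply: measurable_funD => //.
exact: measurable_funM.
Qed.

Lemma measurable_shear2 a : measurable_fun setT (shear2 a).
Proof.
apply: measurable_fun_pair => //=; apply: measurable_funD => //.
exact: measurable_funM.
Qed.

(** [leb2] is built by integrating over the first coordinate. Uniqueness of the product measure
    gives the opposite order, which a horizontal shear calls for. *)
Lemma leb2_sectionE A : measurable A ->
  leb2 A = (\int[lebesgue_measure]_y lebesgue_measure (ysection A y))%E.
Proof.
move=> mA; rewrite /leb2 -[RHS]/((lebesgue_measure \x^ lebesgue_measure)%E A).
by apply: product_measure_unique => // B C mB mC; rewrite /= product_measure2E.
Qed.

(** A shear translates each section by an amount that is constant along the section, so translation
    invariance applies section by section. *)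
Lemma leb2_shear2 a A : measurable A -> leb2 (shear2 a @^-1` A) = leb2 A.
Proof.
move=> mA; rewrite /leb2 /product_measure1 /=; apply: eq_integral => x _ /=.
rewrite -[RHS](lebesgue_measure_shift _ (a * x)); last exact: measurable_xsection.
by congr lebesgue_measure; apply/seteqP; split => y /=; rewrite !xsectionE.
Qed.

Lemma leb2_shear1 a A : measurable A -> leb2 (shear1 a @^-1` A) = leb2 A.
Proof.
move=> mA; rewrite !leb2_sectionE //; last first.
  by rewrite -[_ @^-1` _]setTI; exact: measurable_shear1.
apply: eq_integral => y _ /=.
rewrite -[RHS](lebesgue_measure_shift _ (a * y)); last exact: measurable_ysection.
by congr lebesgue_measure; apply/seteqP; split => x /=; rewrite !ysectionE.
Qed.

Lemma leb2_rot c s A : c ^+ 2 + s ^+ 2 = 1 -> measurable A ->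
  leb2 (rot c s @^-1` A) = leb2 A.
Proof.
have gen : forall c s A, c ^+ 2 + s ^+ 2 = 1 -> 1 + c != 0 -> measurable A ->
    leb2 (rot c s @^-1` A) = leb2 A.
  (* A rotation of angle other than [pi] is a product of three shears. *)
  move=> {c s A} c s A cs c1 mA.
  (* If [c] and [s] are the cosine and sine of an angle, [a] is minus the tangent of half that
     angle. *)
  pose a : R := - s / (1 + c).
  have mS1 B : measurable B -> measurable (shear1 a @^-1` B).
    by move=> mB; rewrite -[_ @^-1` _]setTI; exact: measurable_shear1.
  have mS2 B : measurable B -> measurable (shear2 s @^-1` B).
    by move=> mB; rewrite -[_ @^-1` _]setTI; exact: measurable_shear2.
  rewrite (_ : rot c s @^-1` A =
    shear1 a @^-1` (shear2 s @^-1` (shear1 a @^-1` A))).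
    by rewrite !(leb2_shear1, leb2_shear2) //; do ?[apply: mS1|apply: mS2].
  suff E : rot c s =1 shear1 a \o (shear2 s \o shear1 a).
    by apply/seteqP; split => x /=; rewrite E.
  move=> [x y]; rewrite /rot /shear1 /shear2 /=.
  have s2 : s * s = (1 - c) * (1 + c) by rewrite -expr2 -[s ^+ 2](addKr (c ^+ 2)) cs; ring.
  have ek : a * (1 + c) = - s by rewrite divfK.
  have e1 : a * s = c - 1 by rewrite /a mulrAC mulNr s2 -mulNr mulfK //; ring.
  congr pair.
  - rewrite [RHS](_ : _ = (1 + a * s) * x + a * (1 + (1 + a * s)) * y); last by ring.
    by rewrite e1 (addrC 1 (c - 1)) subrK ek mulNr.
  - rewrite [RHS](_ : _ = s * x + (1 + a * s) * y); last by ring.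
    by rewrite e1 (addrC 1 (c - 1)) subrK.
move=> cs mA; have [c1|] := eqVneq (1 + c) 0; last by move=> c1; exact: gen.
have cE : c = -1 by lra.
have s0 : s = 0.
  by apply/eqP; rewrite -sqrf_eq0; apply/eqP; move: cs; rewrite cE sqrrN expr1n; lra.
have cs' : (0 : R) ^+ 2 + 1 ^+ 2 = 1 by rewrite expr0n expr1n add0r.
have n1 : 1 + 0 != 0 :> R by rewrite addr0 oner_neq0.
(* The half turn, which the three shears do not reach, is the square of the quarter turn. *)
have -> : rot c s @^-1` A = rot 0 1 @^-1` (rot 0 1 @^-1` A).
  apply/seteqP; split => -[x y] /=; rewrite /rot /= cE s0.
    by rewrite !mul0r !mul1r !sub0r !addr0 subr0 add0r !mulN1r.
  by rewrite !mul0r !mul1r !sub0r !addr0 subr0 add0r !mulN1r.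
rewrite !gen //.
have m : measurable_fun setT (rot 0 1 : R * R -> R * R).
  apply: measurable_fun_pair => /=.
    by apply: measurable_funB; apply: measurable_funM.
  by apply: measurable_funD; apply: measurable_funM.
by rewrite -[_ @^-1` _]setTI; exact: m.
Qed.

(* With [rho = v t]: squared distances from the origin at times [0] and [t] of a
   station starting at [x] in direction [phi]. A static station seen from a UE
   moving in direction [phi] corresponds to [rho = - v t]. *)
Definition sqdists (rho : R) (xphi : (R * R) * R) : R * R :=
  (xphi.1.1 ^+ 2 + xphi.1.2 ^+ 2,
   (xphi.1.1 + rho * cos xphi.2) ^+ 2 + (xphi.1.2 + rho * sin xphi.2) ^+ 2).

Lemma measurable_sqdists rho : measurable_fun setT (sqdists rho).
Proof.
have m1 : measurable_fun setT (fun u : (R * R) * R => u.1.1).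
  by apply: measurableT_comp.
have m2 : measurable_fun setT (fun u : (R * R) * R => u.1.2).
  by apply: measurableT_comp.
have mc : measurable_fun setT (fun u : (R * R) * R => cos u.2).
  by apply: measurableT_comp => //; apply: continuous_measurable_fun; exact: continuous_cos.
have ms : measurable_fun setT (fun u : (R * R) * R => sin u.2).
  by apply: measurableT_comp => //; apply: continuous_measurable_fun; exact: continuous_sin.
apply: measurable_fun_pair => /=; apply: measurable_funD; apply: measurable_funX => //.
  by apply: measurable_funD => //; apply: measurable_funM.
by apply: measurable_funD => //; apply: measurable_funM.
Qed.

(** A rotation brings any direction to 0, and changing the sign of [rho] amounts to adding [pi] to
    the direction. So the area depends on [rho] only through its absolute value, which is what makes
    the two models comparable. *)
Lemma leb2_sqdists (rho phi rho' phi' : R) (L : set (R * R)) :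
  `|rho| = `|rho'| -> measurable L ->
  leb2 [set x | L (sqdists rho (x, phi))] = leb2 [set x | L (sqdists rho' (x, phi'))].
Proof.
have gen r f : measurable L ->
    leb2 [set x | L (sqdists r (x, f))] = leb2 [set x | L (sqdists r (x, 0))].
  move=> mL; rewrite -[LHS](@leb2_rot (cos f) (sin f)) ?cos2Dsin2 //; last first.
    rewrite -[X in measurable X]setTI.
    by apply: (measurable_fun_pair1 f (measurable_sqdists r)).
  congr leb2; apply/seteqP; split => -[x y] /=; rewrite /sqdists /rot /= cos0 sin0.
    have E1 : (cos f * x - sin f * y) ^+ 2 + (sin f * x + cos f * y) ^+ 2 = x ^+ 2 + y ^+ 2.
      transitivity ((cos f ^+ 2 + sin f ^+ 2) * (x ^+ 2 + y ^+ 2)); first by ring.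
      by rewrite cos2Dsin2 mul1r.
    have E2 : (cos f * x - sin f * y + r * cos f) ^+ 2 + (sin f * x + cos f * y + r * sin f) ^+ 2 = (x + r * 1) ^+ 2 + (y + r * 0) ^+ 2.
      transitivity ((cos f ^+ 2 + sin f ^+ 2) * ((x + r) ^+ 2 + y ^+ 2)); first by ring.
      by rewrite cos2Dsin2; ring.
    by rewrite E1 E2.
    have E1 : (cos f * x - sin f * y) ^+ 2 + (sin f * x + cos f * y) ^+ 2 = x ^+ 2 + y ^+ 2.
      transitivity ((cos f ^+ 2 + sin f ^+ 2) * (x ^+ 2 + y ^+ 2)); first by ring.
      by rewrite cos2Dsin2 mul1r.
    have E2 : (cos f * x - sin f * y + r * cos f) ^+ 2 + (sin f * x + cos f * y + r * sin f) ^+ 2 = (x + r * 1) ^+ 2 + (y + r * 0) ^+ 2.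
      transitivity ((cos f ^+ 2 + sin f ^+ 2) * ((x + r) ^+ 2 + y ^+ 2)); first by ring.
      by rewrite cos2Dsin2; ring.
    by rewrite E1 E2.
move=> rr mL; rewrite (gen rho) // [RHS]gen //.
have /orP[/eqP->//|/eqP->] : (rho == rho') || (rho == - rho') by rewrite -eqr_norm2 rr.
rewrite -(gen rho' pi) //; congr leb2; apply/seteqP; split => x /=;
  by rewrite /sqdists /= cos0 sin0 cospi sinpi !mulr0 mulr1 mulrN1.
Qed.
End Geometry.

(** * The uniform law of the direction as a probability measure *)

(* [lebesgue_measure] lives on [measurableTypeR R], whose display is not the
   default one of [R]; hence the repackaging of [unif_angle], and of [leb2] below. *)
Section AngleLaw.
Context {R : realType}.

Let twopi_inv_ge0 : 0 <= (2 * pi : R)^-1.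
Proof. by rewrite invr_ge0 mulr_ge0 // pi_ge0. Qed.

Let scaled : {measure set (measurableTypeR R) -> \bar R} :=
  mscale (NngNum twopi_inv_ge0)
    (mrestr lebesgue_measure (measurable_itv `[0%R, (2 * pi)%R[)).

Definition angle_prob (B : set R) : \bar R := unif_angle B.

Let angle_probE : angle_prob = scaled.
Proof. by apply/funext => B; rewrite /scaled /= /mscale /= muleC. Qed.

Let angle_prob0 : angle_prob set0 = 0%E.
Proof. by rewrite angle_probE measure0. Qed.

Let angle_prob_ge0 B : (0 <= angle_prob B)%E.
Proof. by rewrite angle_probE measure_ge0. Qed.

Let angle_prob_sigma_additive : semi_sigma_additive angle_prob.
Proof.
rewrite angle_probE => F mF tF mUF.
exact: (@measure_semi_sigma_additive _ _ _ scaled F mF tF mUF).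
Qed.

HB.instance Definition _ := isMeasure.Build default_measure_display R R
  angle_prob angle_prob0 angle_prob_ge0 angle_prob_sigma_additive.

Let angle_prob_setT : angle_prob setT = 1%E.
Proof.
have p0 : 0 < 2 * pi :> R by rewrite mulr_gt0 // pi_gt0.
rewrite /angle_prob /unif_angle setTI lebesgue_measure_itv /= lte_fin p0.
by rewrite -EFinB subr0 -EFinM mulfV // gt_eqF.
Qed.

HB.instance Definition _ :=
  Measure_isProbability.Build _ _ _ angle_prob angle_prob_setT.

End AngleLaw.

(** * Extension of identities from rectangles to measurable sets *)

Section CoordinatewiseUniqueness.
Context {R : realType} {dX : measure_display} {X : measurableType dX}.
Implicit Types (mu : set X -> \bar R) (D : nat -> set X).
Local Open Scope ereal_scope.

(** The set functions to be compared arise by letting one coordinate of an expression vary. These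
    three properties on measurable sets are what Dynkin induction asks of them, without packaging
    each one as a measure. *)
Definition finite_measure_like mu :=
  [/\ forall S, measurable S -> mu S \is a fin_num,
      forall S, measurable S -> mu S + mu (~` S) = mu setT &
      forall F : (set X)^nat, (forall n, measurable (F n)) ->
        trivIset setT F -> mu (\bigcup_n F n) = \sum_(n <oo) mu (F n)].

(** Dynkin's pi-lambda theorem: agreement passes to complements, since the total masses agree and
    are finite, and to disjoint unions. *)
Lemma finite_measure_like_ext (G : set (set X)) mu1 mu2 :
  @measurable _ X = <<s G >> -> setI_closed G -> G setT ->
  finite_measure_like mu1 -> finite_measure_like mu2 ->
  (forall S, G S -> mu1 S = mu2 S) ->
  forall S, measurable S -> mu1 S = mu2 S.
Proof.
move=> GE GI GT [f1 c1 s1] [f2 c2 s2] E12 S; rewrite GE.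
apply: (dynkin_induction (P := fun S => mu1 S = mu2 S)) => //.
- exact: E12.
- move=> A mA E.
  have := etrans (c1 _ mA) (etrans (E12 _ GT) (esym (c2 _ mA))).
  move/(congr1 (fun u => u - mu2 A)).
  by rewrite E ![mu2 A + _]addeC !addeK // f2.
- move=> F mF tF EF; rewrite s1 // s2 //.
  by apply: eq_eseriesr => n _; exact: EF.
Qed.

Definition upd D i S : nat -> set X := fun j => if j == i then S else D j.

(** The coordinates are freed one at a time: in the induction those below [k] are arbitrary
    measurable sets and the others still belong to [G]. Thus no sigma-algebra on [m]-tuples has to
    be handled. *)
Lemma coordinatewise_ext (G : set (set X)) (m : nat) (F1 F2 : (nat -> set X) -> \bar R) :
  @measurable _ X = <<s G >> -> setI_closed G -> G setT ->
  (forall D i, (i < m)%N -> (forall j, measurable (D j)) ->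
    finite_measure_like (fun S => F1 (upd D i S))) ->
  (forall D i, (i < m)%N -> (forall j, measurable (D j)) ->
    finite_measure_like (fun S => F2 (upd D i S))) ->
  (forall D, (forall j, G (D j)) -> F1 D = F2 D) ->
  forall D, (forall j, measurable (D j)) -> (forall j, (m <= j)%N -> D j = setT) ->
  F1 D = F2 D.
Proof.
move=> GE GI GT fm1 fm2 E12.
have mG S : G S -> measurable S.
  by move=> GS; rewrite GE; exact: sub_gen_smallest.
suff H k : (k <= m)%N -> forall D, (forall j, measurable (D j)) ->
    (forall j, (k <= j)%N -> G (D j)) -> F1 D = F2 D.
  by move=> D mD DT; apply: (H m) => // j /DT ->.
elim: k => [_ D _ GD|k IH km D mD GD]; first by apply: E12 => j; exact: GD.
have -> : D = upd D k (D k) by apply/funext => j; rewrite /upd; case: eqP => [->|].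
apply: (finite_measure_like_ext G (fun S => F1 (upd D k S)) (fun S => F2 (upd D k S))) => //.
- exact: fm1.
- exact: fm2.
- move=> S GS; apply: IH => [|j|j]; first exact: ltnW.
  + by rewrite /upd; case: eqP => // _; exact: mG.
  + rewrite /upd leq_eqVlt => /orP[/eqP->|kj]; first by rewrite eqxx.
    by case: eqP => // _; exact: GD.
Qed.

End CoordinatewiseUniqueness.

Section FiniteMeasureLike.
Context {R : realType} {d : measure_display} {T : measurableType d}.
Variable P : probability T R.
Local Open Scope ereal_scope.

Lemma measurable_forall_lt (m : nat) (B : nat -> set T) :
  (forall j, measurable (B j)) ->
  measurable [set w | forall j, (j < m)%N -> B j w].
Proof.
move=> mB; rewrite (_ : [set w | _] = \bigcap_j (if (j < m)%N then B j else setT)).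
  by apply: bigcapT_measurable => j; case: ifP.
apply/seteqP; split => w /=.
  by move=> H j _; case: ifP => // /H.
by move=> H j jm; have := H j I; rewrite jm.
Qed.

Lemma fdd_finite_measure_like {dX} {X : measurableType dX} (xi : nat -> T -> X)
    (m i : nat) (D : nat -> set X) :
  (i < m)%N -> (forall j, measurable_fun setT (xi j)) -> (forall j, measurable (D j)) ->
  finite_measure_like
    (fun S => P [set w | forall j, (j < m)%N -> upd D i S j (xi j w)]).
Proof.
move=> im mxi mD.
pose E := [set w | forall j, (j < m)%N -> upd D i setT j (xi j w)].
have mxiS j S : measurable S -> measurable (xi j @^-1` S).
  by move=> mS; rewrite -[_ @^-1` _]setTI; exact: mxi.
have mE : measurable E.
  apply: measurable_forall_lt => j; apply: (mxiS j).
  by rewrite /upd; case: eqP.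
have EE S : [set w | forall j, (j < m)%N -> upd D i S j (xi j w)] =
    E `&` xi i @^-1` S.
  apply/seteqP; split => w /=.
    move=> H; split; last by have := H i im; rewrite /upd eqxx.
    by move=> j /H; rewrite /upd; case: eqP.
  by move=> [H Sw] j /H; rewrite /upd; case: eqP => // ->.
split => [S mS|S mS|F mF tF]; rewrite ?EE.
- by apply: fin_num_measure; apply: measurableI => //; exact: mxiS.
- rewrite preimage_setT setIT (measureDI P mE (mxiS i S mS)) addeC.
  by rewrite -preimage_setC setDE.
- rewrite preimage_bigcup setI_bigcupr measure_semi_bigcup //.
  + by apply: eq_eseriesr => n _; rewrite EE.
  + by move=> n; apply: measurableI => //; exact: mxiS.
  + apply/trivIsetP => a b _ _ ab; apply/seteqP; split => // w [[_ Fa] [_ Fb]].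
    have : (F a `&` F b) (xi i w) by [].
    by move/trivIsetP: tF => /(_ a b I I ab) ->.
  + by apply: bigcup_measurable => n _; apply: measurableI => //; exact: mxiS.
Qed.

(** This is the shape of the right-hand side of [aerial_joint] as a function of one of its sets,
    with [g] the product of the other factors. *)
Lemma section_finite_measure_like {dX dY} {X : measurableType dX}
    {Y : measurableType dY} (U : probability Y R) (z : T -> X) (g : T -> R) :
  measurable_fun setT z -> measurable_fun setT g ->
  (forall w, (0 <= g w <= 1)%R) ->
  finite_measure_like (fun S : set (X * Y) =>
    \int[P]_w ((g w)%:E * U (xsection S (z w)))).
Proof.
move=> mz mg g01.
have g0 w : (0 <= (g w)%:E) by rewrite lee_fin; have /andP[] := g01 w.
have mU (S : set (X * Y)) : measurable S ->
    measurable_fun setT (fun w => (g w)%:E * U (xsection S (z w))).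
  move=> mS; apply: emeasurable_funM; first exact/measurable_EFinP.
  by apply: (measurableT_comp (measurable_fun_xsection U mS)).
have U0 S w : 0 <= (g w)%:E * U (xsection S (z w)) by rewrite mule_ge0.
split => [S mS|S mS|F mF tF].
- rewrite ge0_fin_numE; last by apply: integral_ge0.
  apply: (@le_lt_trans _ _ (\int[P]_w (cst 1 w))).
    apply: ge0_le_integral => //; first exact: mU.
    move=> w _; rewrite -[leRHS]mule1; apply: lee_pmul => //.
      by rewrite lee_fin; have /andP[] := g01 w.
    by apply: probability_le1; exact: measurable_xsection.
  by rewrite integral_cst //= probability_setT mule1 ltry.
- rewrite -ge0_integralD //; [|exact: mU|by apply: mU; exact: measurableC].
  apply: eq_integral => w _; rewrite -ge0_muleDr //; congr (_ * _).
  have mx := measurable_xsection (z w) mS.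
  rewrite -measureU //; [|by apply: measurable_xsection; exact: measurableC|].
    by rewrite !xsectionE -preimage_setU setUv.
  by rewrite !xsectionE -preimage_setI setICr preimage_set0.
- rewrite -integral_nneseries //; last by move=> n; exact: mU.
  apply: eq_integral => w _; rewrite nneseriesZl; last by [].
  rewrite xsection_bigcup measure_semi_bigcup //.
  + by move=> n; exact: measurable_xsection.
  + exact: trivIset_xsection.
  + by apply: bigcup_measurable => n _; exact: measurable_xsection.
Qed.

Definition rectangles {dX dY} (X : measurableType dX) (Y : measurableType dY) :
  set (set (X * Y)) :=
  [set A `*` B | A in measurable & B in measurable].

Lemma setI_closed_rectangles {dX dY} (X : measurableType dX) (Y : measurableType dY) :
  setI_closed (@rectangles _ _ X Y).
Proof.
move=> _ _ [A mA [B mB <-]] [A' mA' [B' mB' <-]].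
exists (A `&` A'); first exact: measurableI.
by exists (B `&` B'); [exact: measurableI|rewrite setXI].
Qed.

Lemma rectanglesT {dX dY} (X : measurableType dX) (Y : measurableType dY) :
  (@rectangles _ _ X Y) setT.
Proof. by exists setT => //; exists setT => //; rewrite setXTT. Qed.

Lemma rectangles_choice {dX dY} (X : measurableType dX) (Y : measurableType dY)
    (D : nat -> set (X * Y)) : (forall j, rectangles X Y (D j)) ->
  exists (C : nat -> set X) (B : nat -> set Y),
    [/\ forall j, measurable (C j), forall j, measurable (B j) &
        D = fun j => C j `*` B j].
Proof.
move=> GD.
have /choice[CB HCB] : forall j, exists CB : set X * set Y,
    [/\ measurable CB.1, measurable CB.2 & D j = CB.1 `*` CB.2].
  by move=> j; have [C mC [B mB <-]] := GD j; exists (C, B).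
exists (fun j => (CB j).1), (fun j => (CB j).2); split.
- by move=> j; have [] := HCB j.
- by move=> j; have [] := HCB j.
- by apply/funext => j; have [] := HCB j.
Qed.

End FiniteMeasureLike.

(** * Joint laws of positions and directions *)

Section JointLaws.
Context {R : realType} {d : measure_display} {T : measurableType d}.
Variable P : probability T R.
Local Open Scope ereal_scope.

(** When every [D j] is a rectangle this is the independence in the model: the constraints on the
    single direction merge into one. The general case follows by [coordinatewise_ext]. *)
Lemma terrestrial_joint (lam : R) (y : nat -> T -> R * R) (th : T -> R) :
  terrestrial_model P lam y th ->
  forall m (D : nat -> set ((R * R) * R)), (forall j, measurable (D j)) ->
  P [set w | forall j, (j < m)%N -> D j (y j w, th w)] =
  (P \x angle_prob) [set u | forall j, (j < m)%N -> D j (y j u.1, u.2)].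
Proof.
move=> [[my _] [mth indep]] m D mD.
(* Padding with [setT] from index [m] on meets the last hypothesis of [coordinatewise_ext]. *)
pose D' j := if (j < m)%N then D j else setT.
pose Q : probability (T * R)%type R := (P \x angle_prob).
pose xi1 j w := (y j w, th w).
pose xi2 j (u : T * R) := (y j u.1, u.2).
have -> : [set w | forall j, (j < m)%N -> D j (y j w, th w)] =
    [set w | forall j, (j < m)%N -> D' j (xi1 j w)].
  apply/seteqP; split => w /= H j jm; have := H j jm; rewrite /D' jm //.
have -> : [set u | forall j, (j < m)%N -> D j (y j u.1, u.2)] =
    [set w | forall j, (j < m)%N -> D' j (xi2 j w)].
  apply/seteqP; split => w /= H j jm; have := H j jm; rewrite /D' jm //.
apply: (coordinatewise_ext (rectangles (R * R)%type R) m
  (fun D => P [set w | forall j, (j < m)%N -> D j (xi1 j w)])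
  (fun D => Q [set w | forall j, (j < m)%N -> D j (xi2 j w)])) => //.
- exact: measurable_prod_measurableType.
- exact: setI_closed_rectangles.
- exact: rectanglesT.
- move=> D0 i im mD0; apply: fdd_finite_measure_like => // j.
  by apply: measurable_fun_pair.
- move=> D0 i im mD0; apply: fdd_finite_measure_like => // j.
  by apply: measurable_fun_pair => //; apply: (measurableT_comp (my j)).
- move=> D0 /rectangles_choice[C [B [mC mB ->]]].
  have -> : [set w | forall j, (j < m)%N -> (C j `*` B j) (xi1 j w)] =
      [set w | (forall i, (i < m)%N -> C i (y i w)) /\
        [set r | forall j, (j < m)%N -> B j r] (th w)].
    apply/seteqP; split => w /=.
      by move=> H; split => j /H [].
    by move=> [H1 H2] j jm; split; [exact: H1|exact: H2].
  have -> : [set w | forall j, (j < m)%N -> (C j `*` B j) (xi2 j w)] =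
      [set w | (forall i, (i < m)%N -> C i (y i w))] `*`
        [set r | forall j, (j < m)%N -> B j r].
    apply/seteqP; split => w /=.
      by move=> H; split => j /H [].
    by move=> [H1 H2] j jm; split; [exact: H1|exact: H2].
  rewrite indep //; last exact: measurable_forall_lt.
  rewrite -/(angle_prob _) /= product_measure1E //; last exact: measurable_forall_lt.
  apply: (measurable_forall_lt m (fun j => y j @^-1` C j)) => j.
  by rewrite -[_ @^-1` _]setTI; exact: my.
- by move=> j; rewrite /D'; case: ifP.
- by move=> j; rewrite /D' leqNgt => /negbTE ->.
Qed.

(** Given the positions, the directions are independent and uniform, so station [j] meets its
    constraint with conditional probability the measure of the section of [D j] at its position. *)
Lemma aerial_joint (lam : R) (z : nat -> T -> R * R) (ph : nat -> T -> R) :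
  aerial_model P lam z ph ->
  forall m (D : nat -> set ((R * R) * R)), (forall j, measurable (D j)) ->
  P [set w | forall j, (j < m)%N -> D j (z j w, ph j w)] =
  \int[P]_w (\prod_(j < m) fine (angle_prob (xsection (D j) (z j w))))%:E.
Proof.
move=> [[mz _] [mph indep]] m D mD.
pose D' j := if (j < m)%N then D j else setT.
pose sec (D : set ((R * R) * R)) x := fine (angle_prob (xsection D x)).
have sec01 S x : measurable S -> (0 <= sec S x <= 1)%R.
  move=> mS; rewrite /sec fine_ge0 //= -lee_fin fineK.
    by apply: probability_le1; exact: measurable_xsection.
  by apply: fin_num_measure; exact: measurable_xsection.
have msec S j : measurable S -> measurable_fun setT (fun w => sec S (z j w)).
  move=> mS; apply: (@measurableT_comp _ _ _ _ _ _ fine) => //.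
  by apply: (measurableT_comp (measurable_fun_xsection angle_prob mS)).
pose xi1 j w := (z j w, ph j w).
have -> : [set w | forall j, (j < m)%N -> D j (z j w, ph j w)] =
    [set w | forall j, (j < m)%N -> D' j (xi1 j w)].
  apply/seteqP; split => w /= H j jm; have := H j jm; rewrite /D' jm //.
have -> : \int[P]_w (\prod_(j < m) sec (D j) (z j w))%:E =
    \int[P]_w (\prod_(j < m) sec (D' j) (z j w))%:E.
  by apply: eq_integral => w _; congr EFin; apply: eq_bigr => j _; rewrite /D' ltn_ord.
apply: (coordinatewise_ext (rectangles (R * R)%type R) m
  (fun D => P [set w | forall j, (j < m)%N -> D j (xi1 j w)])
  (fun D => \int[P]_w (\prod_(j < m) sec (D j) (z j w))%:E)) => //.
- exact: measurable_prod_measurableType.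
- exact: setI_closed_rectangles.
- exact: rectanglesT.
- move=> D0 i im mD0; apply: fdd_finite_measure_like => // j.
  by apply: measurable_fun_pair.
- move=> D0 i im mD0.
  pose g w := (\prod_(j < m | j != Ordinal im) sec (D0 j) (z j w))%R.
  have [H1 H2 H3] : finite_measure_like (fun S : set ((R * R) * R) =>
      \int[P]_w ((g w)%:E * angle_prob (xsection S (z i w)))).
    apply: section_finite_measure_like => //.
      rewrite (_ : g = fun w => (\prod_(j < m)
          (if j != Ordinal im then sec (D0 j) (z j w) else 1))%R).
        by apply: measurable_prod => j _; case: (j != Ordinal im) => //; exact: msec.
      by apply/funext => w; rewrite /g big_mkcond.
    move=> w; apply/andP; split.
      by apply: prodr_ge0 => j _; have /andP[] := sec01 _ (z j w) (mD0 j).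
    by apply: prodr_ile1 => j _; exact: sec01.
  have E S : measurable S -> \int[P]_w (\prod_(j < m) sec (upd D0 i S j) (z j w))%:E =
      \int[P]_w ((g w)%:E * angle_prob (xsection S (z i w))).
    move=> mS; apply: eq_integral => w _.
    rewrite (bigD1 (Ordinal im)) //= {1}/upd eqxx mulrC EFinM; congr (_ * _).
      congr EFin; apply: eq_bigr => j ji; rewrite /upd.
      by case: eqP => // ji'; move: ji; rewrite -val_eqE /= ji' eqxx.
    by rewrite fineK //; apply: fin_num_measure; exact: measurable_xsection.
  split => [S mS|S mS|F mF tF].
  + by rewrite E //; exact: H1.
  + by rewrite !E //; [exact: H2|exact: measurableC].
  + rewrite E; last by apply: bigcup_measurable => n _; exact: mF.
    by rewrite H3 //; apply: eq_eseriesr => n _; rewrite E.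
- move=> D0 /rectangles_choice[C [B [mC mB ->]]].
  have -> : [set w | forall j, (j < m)%N -> (C j `*` B j) (xi1 j w)] =
      [set w | forall i, (i < m)%N -> C i (z i w) /\ B i (ph i w)].
    by [].
  rewrite indep //.
  set E := [set w | _].
  have mE : measurable E.
    apply: (measurable_forall_lt m (fun j => z j @^-1` C j)) => j.
    by rewrite -[_ @^-1` _]setTI; exact: mz.
  pose c := (\prod_(j < m) fine (@angle_prob R (B j)))%R.
  have c0 : (0 <= c)%R by apply: prodr_ge0 => j _; rewrite fine_ge0.
  (* For rectangles each section is either [B j] or empty, so the integrand is the constant [c] on
     [E] and 0 elsewhere. *)
  transitivity (\int[P]_w (c%:E * (\1_E w)%:E)).
    rewrite ge0_integralZl_EFin //; last exact/measurable_EFinP.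
    rewrite integral_indic // setIT muleC; congr (_ * _).
    rewrite /c -prodEFin; apply: eq_bigr => j _.
    by rewrite fineK // fin_num_measure.
  apply: eq_integral => w _; rewrite -EFinM; congr EFin.
  rewrite indicE; have [Ew|nEw] := boolP (w \in E).
    rewrite mulr1; apply: eq_bigr => j _; rewrite /sec in_xsectionX //.
    by rewrite inE; move: Ew; rewrite inE; exact.
  rewrite mulr0; move: nEw; rewrite notin_setE /E /= => /existsNP[i /not_implyP[im nC]].
  rewrite (bigD1 (Ordinal im)) //= /sec notin_xsectionX ?measure0 ?mul0r //.
  by rewrite notin_setE.
- by move=> j; rewrite /D'; case: ifP.
- by move=> j; rewrite /D' leqNgt => /negbTE ->.
Qed.

End JointLaws.

(** * Infinite products and the Poisson generating function *)

Section InfiniteProducts.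
Context {R : realType}.
Implicit Types u v : nat -> R.

Definition infprod u : R := limn (fun m => \prod_(i < m) u i).

Lemma is_cvg_infprod u : (forall i, 0 <= u i <= 1) ->
  cvgn (fun m => \prod_(i < m) u i).
Proof.
move=> u01; apply: nonincreasing_is_cvgn.
  apply/nonincreasing_seqP => n; rewrite big_ord_recr /= ler_piMr //.
    by apply: prodr_ge0 => i _; have /andP[] := u01 i.
  by have /andP[] := u01 n.
exists 0 => _ [n _ <-]; apply: prodr_ge0 => i _; by have /andP[] := u01 i.
Qed.

Lemma infprod_01 u : (forall i, 0 <= u i <= 1) -> 0 <= infprod u <= 1.
Proof.
move=> u01; apply/andP; split.
  apply: limr_ge; first exact: is_cvg_infprod.
  by apply: nearW => n; apply: prodr_ge0 => i _; have /andP[] := u01 i.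
apply: limr_le; first exact: is_cvg_infprod.
by apply: nearW => n; apply: prodr_ile1 => i _.
Qed.

Lemma infprodM u v : (forall i, 0 <= u i <= 1) -> (forall i, 0 <= v i <= 1) ->
  infprod (fun i => u i * v i) = infprod u * infprod v.
Proof.
move=> u01 v01; rewrite /infprod -limM; [|exact: is_cvg_infprod|exact: is_cvg_infprod].
by congr (limn _); apply/funext => m /=; rewrite big_split.
Qed.

Lemma infprod_prod (n : nat) (U : nat -> nat -> R) :
  (forall j i, 0 <= U j i <= 1) ->
  infprod (fun i => \prod_(j < n) U j i) = \prod_(j < n) infprod (U j).
Proof.
move=> U01; elim: n => [|n IH].
  rewrite big_ord0 /infprod; apply: (@lim_near_cst R) => //.
  by apply: nearW => m; rewrite big1 // => i _; rewrite big_ord0.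
rewrite big_ord_recr /= -IH -infprodM //; last first.
  move=> i; apply/andP; split.
    by apply: prodr_ge0 => j _; have /andP[] := U01 j i.
  by apply: prodr_ile1.
by congr (limn _); apply/funext => m; apply: eq_bigr => i _; rewrite big_ord_recr.
Qed.

Lemma le_infprod u v : (forall i, 0 <= u i <= v i) -> (forall i, v i <= 1) ->
  infprod u <= infprod v.
Proof.
move=> uv v1; apply: ler_lim.
- apply: is_cvg_infprod => i; have /andP[-> h] := uv i.
  exact: le_trans h (v1 i).
- apply: is_cvg_infprod => i; have /andP[h1 h2] := uv i.
  by rewrite v1 (le_trans h1 h2).
- by apply: nearW => m; apply: ler_prod => i _.
Qed.

(** The partial sums are nondecreasing integers bounded by [k]. If they never reached [k] they would
    stay at or below [k.-1], and so would the limit. *)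
Lemma eseries_bool_eventually (b : nat -> bool) (k : nat) :
  (\sum_(0 <= i <oo) ((b i)%:R : R)%:E)%E = (k%:R)%:E ->
  exists M, forall m, (M <= m)%N -> (\sum_(i < m) b i)%N = k.
Proof.
move=> H; pose c m := (\sum_(i < m) b i)%N.
have cE m : (\sum_(0 <= i < m) ((b i)%:R : R)%:E)%E = ((c m)%:R)%:E.
  by rewrite sumEFin big_mkord natr_sum.
have cS m : c m.+1 = (c m + b m)%N by rewrite /c big_ord_recr.
have cmono : {homo c : m n / (m <= n)%N}.
  move=> m n /subnKC <-; elim: (n - m)%N => [|l IH]; first by rewrite addn0.
  by rewrite addnS cS (leq_trans IH) // leq_addr.
have ck m : (c m <= k)%N.
  rewrite -(@ler_nat R) -lee_fin -cE -H; apply: nneseries_lim_ge => i _ _.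
  by rewrite lee_fin.
have [M kM] : exists M, (k <= c M)%N.
  apply: contrapT => /forallNP Hn.
  have ckS m : (c m <= k.-1)%N.
    by have := Hn m; case: (k) => // k' /negP; rewrite -ltnNge ltnS.
  have k0 : (0 < k)%N by have := Hn 0%N; case: (k) => //; rewrite leq0n.
  have : ((k%:R : R)%:E <= (k.-1%:R)%:E)%E.
    rewrite -H; apply: lime_le.
      by apply: is_cvg_nneseries => i _ _; rewrite lee_fin.
    by apply: nearW => m; rewrite cE lee_fin ler_nat.
  by rewrite lee_fin ler_nat leqNgt prednK // leqnn.
exists M => m Mm; apply/eqP; rewrite eqn_leq ck /=.
exact: leq_trans kM (cmono _ _ Mm).
Qed.

(** For a configuration with [k] points in a set, this evaluates the product that gives each of
    these points the weight [q]. *)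
Lemma infprod_count (b : nat -> bool) (k : nat) (q : R) :
  (\sum_(0 <= i <oo) ((b i)%:R : R)%:E)%E = (k%:R)%:E ->
  infprod (fun i => if b i then q else 1) = q ^+ k.
Proof.
move=> /eseries_bool_eventually[M HM].
rewrite /infprod; apply: (@lim_near_cst R) => //.
exists M => // m /= Mm; rewrite -(HM m Mm).
elim: m {Mm} => [|m IH]; first by rewrite !big_ord0.
by rewrite !big_ord_recr /= IH exprD; case: (b m); rewrite ?expr1 ?expr0.
Qed.

Lemma eseries_bool_finite (b : nat -> bool) (k : nat) :
  (\sum_(0 <= i <oo) ((b i)%:R : R)%:E)%E = (k%:R)%:E ->
  exists M, forall i, b i -> (i < M)%N.
Proof.
move=> /eseries_bool_eventually[M HM]; exists M => i bi.
rewrite ltnNge; apply/negP => Mi.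
have := HM i.+1 (leq_trans Mi (leqnSn i)).
by rewrite big_ord_recr /= bi (HM i Mi) addn1 => /eqP; rewrite -[X in _ == X]addn0 -addn1 eqn_add2l.
Qed.

End InfiniteProducts.

Section PoissonSeries.
Context {R : realType}.

(** The probability generating function of the Poisson law, obtained from the exponential series at
    [mu * q]. *)
Lemma poisson_mass_gen (mu q : R) : 0 <= mu -> 0 <= q ->
  (\sum_(0 <= k <oo) (q ^+ k * poisson_mass mu k)%:E)%E =
  (expR (- (mu * (1 - q))))%:E.
Proof.
move=> mu0 q0.
have -> : expR (- (mu * (1 - q))) = expR (- mu) * expR (mu * q).
  by rewrite -expRD; congr expR; ring.
transitivity (\sum_(0 <= k <oo) ((expR (- mu))%:E * (exp_coeff (mu * q) k)%:E))%E.
  apply: eq_eseriesr => k _; rewrite -EFinM /poisson_mass /exp_coeff /= exprMn.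
  by congr EFin; ring.
rewrite nneseriesZl; last first.
  by move=> k _; rewrite lee_fin /exp_coeff /= divr_ge0 // exprn_ge0 // mulr_ge0.
rewrite EFinM; congr (_ * _)%E; rewrite /expR -EFin_lim.
  by apply: congr_lim; apply/funext => n /=; rewrite /series /= sumEFin.
exact: is_cvg_series_exp_coeff.
Qed.

End PoissonSeries.

(** * Planar Lebesgue measure as a sigma-finite measure *)

Section Leb2Measure.
Context {R : realType}.
Local Open Scope ereal_scope.

Let m2 : {measure set (measurableTypeR R * measurableTypeR R) -> \bar R} :=
  (@lebesgue_measure R) \x (@lebesgue_measure R).

Let leb2_0 : @leb2 R set0 = 0.
Proof. exact: (measure0 m2). Qed.

Let leb2_ge0 A : 0 <= @leb2 R A.
Proof. exact: (measure_ge0 m2). Qed.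

Let leb2_sigma_additive : semi_sigma_additive (@leb2 R).
Proof.
move=> F mF tF mUF.
exact: (@measure_semi_sigma_additive _ _ _ m2 F mF tF mUF).
Qed.

HB.instance Definition _ := isMeasure.Build _ (R * R)%type R
  (@leb2 R) leb2_0 leb2_ge0 leb2_sigma_additive.

Definition square (a : R) : set (R * R) :=
  `[(- a)%R, a]%classic `*` `[(- a)%R, a]%classic.

Lemma measurable_square a : measurable (square a).
Proof. by apply: measurableX; exact: measurable_itv. Qed.

Lemma leb2_square a : leb2 (square a) < +oo.
Proof.
have I : lebesgue_measure (`[(- a)%R, a]%classic : set R) < +oo.
  by rewrite lebesgue_measure_itv /=; case: ifP => _; rewrite -?EFinB ltry.
rewrite /leb2 product_measure1E //; try exact: measurable_itv.
by apply: lte_mul_pinfty => //; rewrite ge0_fin_numE.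
Qed.

Let leb2_sigma_finite : sigma_finite setT (@leb2 R).
Proof.
exists (fun n => square n%:R); last first.
  by move=> n; split; [exact: measurable_square|exact: leb2_square].
apply/seteqP; split => // -[x y] _.
exists (Num.truncn (Num.max `|x| `|y|)%R).+1 => //=.
rewrite /square /= !in_itv /= -!ler_norml.
have := truncnS_gt (Num.max `|x| `|y|)%R.
by rewrite gt_max => /andP[/ltW-> /ltW->].
Qed.

HB.instance Definition _ := Measure_isSigmaFinite.Build _ _ _
  (@leb2 R) leb2_sigma_finite.

End Leb2Measure.

(** * Counts and thinning of a Poisson process *)

Section Counts.
Context {R : realType} {d : measure_display} {T : measurableType d}.
Variables (P : probability T R) (lam : R) (x : nat -> T -> R * R).
Hypotheses (lam0 : 0 < lam) (PPPx : is_PPP P lam x).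
Implicit Types A : set (R * R).
Local Open Scope ereal_scope.

Lemma measurable_count A : measurable A -> measurable_fun setT (count x A).
Proof.
move=> mA; apply: ge0_emeasurable_sum => [k w _ _|k _]; first by rewrite lee_fin.
have mI : measurable_fun setT (\1_A : R * R -> R) by exact: measurable_indic.
by apply/measurable_EFinP; exact: (measurableT_comp mI (PPPx.1 k)).
Qed.

Lemma measurable_count_eq A c : measurable A ->
  measurable [set w | count x A w = c].
Proof.
move=> mA; rewrite -[X in measurable X]setTI.
exact: (measurable_count _ mA measurableT _ (emeasurable_set1 c)).
Qed.

Let mu A := (lam * fine (leb2 A))%R.

Let mu_ge0 A : (0 <= mu A)%R.
Proof. by rewrite /mu mulr_ge0 ?fine_ge0 // ltW. Qed.

Lemma prob_count A k : measurable A -> leb2 A < +oo ->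
  P [set w | count x A w = (k%:R)%:E] = (poisson_mass (mu A) k)%:E.
Proof.
move=> mA Aoo; have := PPPx.2 1%N (fun=> A) (fun=> k).
rewrite big_ord_recl big_ord0 mulr1 => <-.
- congr (P _); apply/seteqP; split => w /=; first by [].
  by move/(_ 0%N isT).
- by [].
- by move=> [|j] [|j'].
Qed.

(** The Poisson masses sum to 1, by [poisson_mass_gen] at [q = 1], which leaves no mass for an
    infinite count. *)
Lemma count_finite_ae A : measurable A -> leb2 A < +oo ->
  P [set w | forall k, count x A w <> (k%:R)%:E] = 0.
Proof.
move=> mA Aoo.
pose E k := [set w | count x A w = (k%:R)%:E].
have mE k : measurable (E k) by exact: measurable_count_eq.
have mU : measurable (\bigcup_k E k) by apply: bigcup_measurable => k _; exact: mE.
have -> : [set w | forall k, count x A w <> (k%:R)%:E] = ~` \bigcup_k E k.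
  apply/seteqP; split => w /=; first by move=> H [k _ /=]; exact: H.
  by move=> H k Ek; apply: H; exists k.
rewrite probability_setC //.
suff -> : P (\bigcup_k E k) = 1 by rewrite subee.
rewrite measure_semi_bigcup //.
- transitivity (\sum_(0 <= k <oo) (1 ^+ k * poisson_mass (mu A) k)%:E).
    by apply: eq_eseriesr => k _; rewrite expr1n mul1r; exact: prob_count.
  by rewrite poisson_mass_gen // subrr mulr0 oppr0 expR0.
- apply/trivIsetP => a b _ _ ab; apply/seteqP; split => // w [/= Ea Eb].
  move: ab; rewrite -(@eqr_nat R); case/eqP.
  by have := etrans (esym Ea) Eb => -[].
Qed.

Lemma count_finite A k w : count x A w = (k%:R)%:E ->
  exists M, forall i, A (x i w) -> (i < M)%N.
Proof.
move=> /eseries_bool_finite[M HM]; exists M => i Ai.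
by apply: HM; rewrite inE.
Qed.

Lemma count_eq0 A w : count x A w = 0 <-> forall i, ~ A (x i w).
Proof.
split.
  move=> /(@eseries_bool_eventually R (fun i => x i w \in A) 0%N)[M HM] i Ai.
  have := HM (maxn i.+1 M) (leq_maxr _ _).
  have im : (i < maxn i.+1 M)%N by rewrite leq_max ltnSn.
  by move=> /eqP; rewrite sum_nat_eq0 => /forallP/(_ (Ordinal im)); rewrite /= mem_set.
by move=> H; apply: eseries0 => i _ _; rewrite indicE memNset.
Qed.

Lemma prob_void A : measurable A -> leb2 A < +oo ->
  P [set w | forall i, ~ A (x i w)] = (expR (- mu A))%:E.
Proof.
move=> mA Aoo; rewrite (_ : [set w | _] = [set w | count x A w = (0%:R)%:E]).
  by rewrite prob_count // /poisson_mass expr0 fact0 mulr1 divr1.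
by apply/seteqP; split => w /= /count_eq0.
Qed.

Section SimpleThinning.
Variables (n : nat) (A : nat -> set (R * R)) (p : nat -> R).
Hypotheses (mA : forall j, (j < n)%N -> measurable (A j) /\ leb2 (A j) < +oo)
  (tA : forall j j', (j < n)%N -> (j' < n)%N -> j <> j' -> A j `&` A j' = set0)
  (p01 : forall j, (j < n)%N -> (0 <= p j <= 1)%R).

(** The conditional probability, given the process, that no point in [A j] survives when each is
    kept independently with probability [p j]. *)
Definition thinned (j : nat) (w : T) : R :=
  infprod (fun i => if x i w \in A j then 1 - p j else 1)%R.

Let u01 j w i : (j < n)%N -> (0 <= (if x i w \in A j then 1 - p j else 1) <= 1)%R.
Proof.
move=> /p01 /andP[p0 p1]; case: ifP => _; last by rewrite ler01 lexx.
by rewrite subr_ge0 p1 /= gerBl.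
Qed.

Lemma thinned01 j w : (j < n)%N -> (0 <= thinned j w <= 1)%R.
Proof. by move=> jn; apply: infprod_01 => i; exact: u01. Qed.

Lemma measurable_thinned j : (j < n)%N -> measurable_fun setT (thinned j).
Proof.
move=> jn; apply: (@measurable_fun_cvg _ _ _ _ (fun m w => \prod_(i < m)
    (if x i w \in A j then 1 - p j else 1))%R); last first.
  by move=> w _; apply: is_cvg_infprod => i; exact: u01.
move=> m; apply: measurable_prod => i _.
rewrite (_ : (fun w => _) = (fun w => 1 - p j * \1_(A j) (x i w))%R).
  apply: measurable_funB => //; apply: measurable_funM => //.
  have mI : measurable_fun setT (\1_(A j) : R * R -> R).
    by apply: measurable_indic; exact: (mA _ jn).1.
  exact: (measurableT_comp mI (PPPx.1 i)).
apply/funext => w; rewrite indicE; case: (_ \in _); by rewrite ?mulr1 // mulr0 subr0.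
Qed.

Let F a (k : nat -> nat) : set T :=
  [set w | forall j, (a <= j < n)%N -> count x (A j) w = ((k j)%:R)%:E].

Let mF a k : measurable (F a k).
Proof.
rewrite (_ : F a k = [set w | forall j, (j < n)%N ->
    (if (a <= j)%N && (j < n)%N then [set w | count x (A j) w = ((k j)%:R)%:E] else setT) w]).
  apply: (measurable_forall_lt n (fun j => if (a <= j)%N && (j < n)%N
    then [set w | count x (A j) w = ((k j)%:R)%:E] else setT)) => j.
  by case: ifP => // /andP[_ jn]; apply: measurable_count_eq; exact: (mA _ jn).1.
apply/seteqP; split => w /=.
  by move=> H j jn; case: ifP => // ajn; exact: H.
by move=> H j ajn; have /andP[_ jn] := ajn; have := H j jn; rewrite ajn.
Qed.

(** For [a = 0] this is the joint Poisson law of the counts. Each induction step sums out the count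
    in one more set, which turns its Poisson mass into a value of the generating function, while the
    later counts remain prescribed. *)
Lemma thinning_partial a (k : nat -> nat) : (a <= n)%N ->
  \int[P]_(w in F a k) (\prod_(j < a) thinned j w)%:E =
  ((\prod_(j < a) expR (- (mu (A j) * p j))) *
    \prod_(a <= j < n) poisson_mass (mu (A j)) (k j))%:E.
Proof.
elim: a k => [k _|a IH k an].
  under eq_integral do rewrite big_ord0.
  rewrite (integral_cst P (mF 0%N k) 1) mul1e big_ord0 mul1r big_mkord -PPPx.2 //.
pose f w := (\prod_(j < a) thinned j w)%R.
have mfa b : (b <= n)%N -> measurable_fun setT (fun w => (\prod_(j < b) thinned j w)%R).
  move=> bn; rewrite (_ : (fun w => _) = fun w => (\prod_(j < b)
      (fun w => if (j < n)%N then thinned j w else 1%R) w)%R).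
    apply: measurable_prod => j _; case: ltnP => // jn; exact: measurable_thinned.
  by apply/funext => w; apply: eq_bigr => j _; rewrite (leq_trans (ltn_ord j) bn).
have fa0 b w : (b <= n)%N -> (0 <= \prod_(j < b) thinned j w)%R.
  move=> bn; apply: prodr_ge0 => j _.
  by have /andP[] := thinned01 _ w (leq_trans (ltn_ord j) bn).
have [mAa Aaoo] := mA _ an.
pose N := [set w | forall l, count x (A a) w <> (l%:R)%:E].
have mN : measurable N.
  rewrite (_ : N = \bigcap_l ~` [set w | count x (A a) w = (l%:R)%:E]).
    by apply: bigcapT_measurable => l; apply: measurableC; exact: measurable_count_eq.
  by apply/seteqP; split => w H l //; [move=> _; exact: H|exact: H l I].
pose k' l j := if j == a then l else k j.
rewrite (ge0_negligible_integral mN (mF _ _)) //; last 3 first.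
- by apply/measurable_EFinP; apply: measurable_funTS; exact: mfa.
- by move=> w _; rewrite lee_fin fa0.
- exact: count_finite_ae.
(* Off the null set [N], the event is split according to the value [l] of the count in [A a]. *)
have -> : F a.+1 k `\` N = \bigcup_l F a (k' l).
  apply/seteqP; split => w /=.
    move=> [Fw /existsNP[l /contrapT cl]]; exists l => // j /andP[aj jn].
    rewrite /k'; case: eqP => [->//|/eqP ja]; apply: Fw.
    by rewrite jn andbT ltn_neqAle eq_sym ja.
  move=> [l _ Fw]; split.
    move=> j /andP[aj jn]; have := Fw j; rewrite jn (ltnW aj) => /(_ isT).
    by rewrite /k' gtn_eqF.
  move=> H; have := Fw a; rewrite leqnn an => /(_ isT); rewrite /k' eqxx; exact: H.
rewrite ge0_integral_bigcup //; last 3 first.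
- by apply/measurable_EFinP; apply: measurable_funTS; exact: mfa.
- by move=> w _; rewrite lee_fin fa0.
- apply/trivIsetP => l l' _ _ ll'; apply/seteqP; split => // w [/= Fl Fl'].
  have := Fl a; have := Fl' a; rewrite leqnn an /k' eqxx => /(_ isT) -> /(_ isT) [].
  by move=> /eqP; rewrite eqr_nat eq_sym (negbTE ll').
pose C := ((\prod_(j < a) expR (- (mu (A j) * p j))) *
  \prod_(a.+1 <= j < n) poisson_mass (mu (A j)) (k j))%R.
have pm0 j l : (0 <= poisson_mass (mu (A j)) l)%R.
  by rewrite /poisson_mass divr_ge0 // mulr_ge0 ?expR_ge0 // exprn_ge0.
have /andP[pa0 pa1] := p01 _ an.
transitivity (\sum_(0 <= l <oo) (C%:E * ((1 - p a) ^+ l * poisson_mass (mu (A a)) l)%:E)).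
  apply: eq_eseriesr => l _.
  transitivity (\int[P]_(w in F a (k' l)) (((1 - p a) ^+ l)%:E * (f w)%:E)).
    apply: eq_integral => w; rewrite inE => Fw.
    rewrite big_ord_recr /= mulrC EFinM; congr (_%:E * _).
    apply: infprod_count; have := Fw a; rewrite leqnn an => /(_ isT).
    by rewrite /k' eqxx.
  rewrite ge0_integralZl_EFin //; last 3 first.
  - by move=> w _; rewrite lee_fin fa0 // ltnW.
  - by apply/measurable_EFinP; apply: measurable_funTS; apply: mfa; exact: ltnW.
  - by rewrite exprn_ge0 // subr_ge0.
  rewrite IH; last exact: ltnW.
  rewrite -!EFinM; congr EFin; rewrite /C big_ltn // {1}/k' eqxx.
  rewrite (eq_big_nat _ _ (F2 := fun j => poisson_mass (mu (A j)) (k j))); last first.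
    by move=> j /andP[aj _]; rewrite /k' gtn_eqF.
  by ring.
rewrite nneseriesZl; last first.
  by move=> l _; rewrite lee_fin mulr_ge0 // exprn_ge0 // subr_ge0.
rewrite poisson_mass_gen ?subr_ge0 // subKr -EFinM; congr EFin.
by rewrite /C big_ord_recr /=; ring.
Qed.

Lemma thinning_simple :
  \int[P]_w (\prod_(j < n) thinned j w)%:E =
  (expR (- \sum_(j < n) mu (A j) * p j))%:E.
Proof.
have := thinning_partial n (fun=> 0%N) (leqnn n).
rewrite (_ : F n _ = setT); last first.
  by apply/seteqP; split => // w _ j /=; rewrite ltnNge; case: leqP.
by rewrite big_geq // mulr1 => ->; rewrite -sumrN expR_sum.
Qed.

End SimpleThinning.

End Counts.

(** Factor out [expR (- a) <= 1] and use [1 + u <= expR u] at [u = a - b]. *)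
Lemma expRN_lip {R : realType} (a b : R) : 0 <= a -> a <= b ->
  expR (- a) - expR (- b) <= b - a.
Proof.
move=> a0 ab.
have -> : expR (- b) = expR (- a) * expR (a - b) by rewrite -expRD; congr expR; ring.
have h1 : expR (- a) <= 1 by rewrite -expR0 ler_expR oppr_le0.
have h2 : 1 + (a - b) <= expR (a - b) by exact: expR_ge1Dx.
have h3 := expR_ge0 (- a).
have h4 : expR (a - b) <= 1 by rewrite -expR0 ler_expR subr_le0.
have : 0 <= (1 - expR (- a)) * (1 - expR (a - b)) by rewrite mulr_ge0 // subr_ge0.
nra.
Qed.

Lemma sandwich_dist {R : realType} (lo hi a b D : R) :
  hi - lo <= D -> lo <= a -> a <= hi -> lo <= b -> b <= hi -> `| a - b | <= D.
Proof. by move=> h1 h2 h3 h4 h5; rewrite ler_norml; apply/andP; split; lra. Qed.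

(** * The generating functional of the Poisson process *)

Section GeneratingFunctional.
Context {R : realType} {d : measure_display} {T : measurableType d}.
Variables (P : probability T R) (lam : R) (x : nat -> T -> R * R).
Hypotheses (lam0 : 0 < lam) (PPPx : is_PPP P lam x).
Local Open Scope ereal_scope.

Lemma measurable_infprod (g : R * R -> R) : measurable_fun setT g ->
  (forall u, (0 <= g u <= 1)%R) ->
  measurable_fun setT (fun w => infprod (fun i => g (x i w))).
Proof.
move=> mg g01; apply: (@measurable_fun_cvg _ _ _ _ (fun m w => \prod_(i < m)
    g (x i w))%R); last first.
  by move=> w _; apply: is_cvg_infprod => i; exact: g01.
move=> m; apply: measurable_prod => i _.
exact: (measurableT_comp mg (PPPx.1 i)).
Qed.

Section Grid.
Variables (p : R * R -> R) (B : set (R * R)) (N : nat).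
Hypotheses (mB : measurable B) (Boo : leb2 B < +oo)
  (mp : measurable_fun setT p) (p01 : forall u, (0 <= p u <= 1)%R)
  (pB : forall u, ~ B u -> p u = 0%R).

Let N1 : R := N.+1%:R.

Let N1_gt0 : (0 < N1)%R. Proof. by rewrite ltr0n. Qed.

(** The bands of [B] on which [p] lies between consecutive multiples of [1 / N.+1]. The indices
    [j < N.+2] cover [B], the last one receiving the points where [p] is 1. *)
Let A (j : nat) : set (R * R) := B `&` p @^-1` `[(j%:R / N1)%R, (j.+1%:R / N1)%R[%classic.

Let idx u := Num.truncn (p u * N1).

Let A_idx j u : A j u -> idx u = j.
Proof.
move=> [_ /=]; rewrite in_itv /= ler_pdivrMr // ltr_pdivlMr // => h.
exact: truncn_def.
Qed.

Let idxP u : ((idx u)%:R <= p u * N1 < (idx u).+1%:R)%R.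
Proof. by apply: truncn_itv; have /andP[p0 _] := p01 u; rewrite mulr_ge0 // ltW. Qed.

Let idx_A u : B u -> A (idx u) u.
Proof.
by move=> Bu; split => //=; rewrite in_itv /= ler_pdivrMr // ltr_pdivlMr // idxP.
Qed.

Let idx_lt u : (idx u < N.+2)%N.
Proof.
rewrite ltnS -(ler_nat R); have /andP[h _] := idxP u; apply: (le_trans h).
rewrite -/N1 -[leRHS]mul1r; apply: ler_wpM2r; first exact: ltW.
by have /andP[] := p01 u.
Qed.

Let mA j : measurable (A j).
Proof.
apply: measurableI => //; rewrite -[X in measurable X]setTI; exact: mp.
Qed.

Let Aoo j : leb2 (A j) < +oo.
Proof.
apply: (@le_lt_trans _ _ (leb2 B)) => //.
apply: le_measure; rewrite ?inE //.
by move=> u [].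
Qed.

Let tA j j' : j <> j' -> A j `&` A j' = set0.
Proof.
move=> jj'; apply/seteqP; split => // u [/A_idx h1 /A_idx h2].
by apply: jj'; rewrite -h1 -h2.
Qed.

Let BE : B = \big[setU/set0]_(j < N.+2) A j.
Proof.
rewrite -bigcup_mkord; apply/seteqP; split => u.
  by move=> Bu; exists (idx u); [exact: idx_lt|exact: idx_A].
by move=> [j _ []].
Qed.

(** The step function with value [1 - q j] on band [j] and 1 outside [B], written as a product so
    that [infprod_prod] can separate the bands. *)
Let g (q : nat -> R) u := (\prod_(j < N.+2) (if u \in A j then 1 - q j else 1))%R.

Let gB q u : B u -> g q u = (1 - q (idx u))%R.
Proof.
move=> Bu; rewrite /g (bigD1 (Ordinal (idx_lt u))) //= mem_set; last exact: idx_A.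
rewrite big1 ?mulr1 // => j; rewrite -val_eqE /= => ji.
by rewrite memNset // => /A_idx h; rewrite h eqxx in ji.
Qed.

Let gNB q u : ~ B u -> g q u = 1%R.
Proof. by move=> nB; rewrite /g big1 // => j _; rewrite memNset // => -[]. Qed.

Let mu j := (lam * fine (leb2 (A j)))%R.

Let mu_ge0 j : (0 <= mu j)%R.
Proof. by rewrite /mu mulr_ge0 ?fine_ge0 // ltW. Qed.

Let pgfl_step (q : nat -> R) : (forall j, (0 <= q j <= 1)%R) ->
  \int[P]_w (infprod (fun i => g q (x i w)))%:E =
  (expR (- \sum_(j < N.+2) mu j * q j))%:E.
Proof.
move=> q01.
rewrite -(thinning_simple P lam x lam0 PPPx N.+2 A q) //.
- apply: eq_integral => w _; congr EFin.
  apply: (infprod_prod N.+2 (fun j i => if x i w \in A j then 1 - q j else 1)%R).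
  move=> j i; case: ifP => _; last by rewrite ler01 lexx.
  by have /andP[q0 q1] := q01 j; rewrite subr_ge0 q1 /= gerBl.
- by move=> j j' _ _; exact: tA.
Qed.

(** Lower and upper bounds of [p] on band [j], capped at 1 so that they remain thinning
    probabilities. *)
Let lo j : R := Num.min (j%:R / N1)%R 1%R.
Let up j : R := Num.min (j.+1%:R / N1)%R 1%R.

Let lo01 j : (0 <= lo j <= 1)%R.
Proof. by rewrite /lo le_min ge_min lexx orbT ler01 !andbT divr_ge0 // ltW. Qed.

Let up01 j : (0 <= up j <= 1)%R.
Proof. by rewrite /up le_min ge_min lexx orbT ler01 !andbT divr_ge0 // ltW. Qed.

Let lo_p u : (lo (idx u) <= p u)%R.
Proof.
by rewrite /lo ge_min ler_pdivrMr //; have /andP[-> _] := idxP u.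
Qed.

Let p_up u : (p u <= up (idx u))%R.
Proof.
rewrite /up le_min ler_pdivlMr //; have /andP[_ /ltW ->] := idxP u.
by have /andP[_ ->] := p01 u.
Qed.

Let up_lo j : (up j <= lo j + N1^-1)%R.
Proof.
rewrite /up /lo -natr1 mulrDl mul1r.
have h : (0 < N1^-1)%R by rewrite invr_gt0.
by rewrite addr_minl le_min !ge_min lexx /= lerDl (ltW h) orbT.
Qed.

Let Slo := (\sum_(j < N.+2) mu j * lo j)%R.
Let Sup := (\sum_(j < N.+2) mu j * up j)%R.

Let sum_mu : (\sum_(j < N.+2) mu j = lam * fine (leb2 B))%R.
Proof.
rewrite -mulr_sumr; congr (_ * _)%R.
rewrite sum_fine; last by move=> j _; rewrite ge0_fin_numE // Aoo.
congr fine; rewrite [in RHS]BE measure_semi_additive_ord_I //.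
- by apply/trivIsetP => i j _ _ /eqP ij; exact: tA.
- by rewrite -BE.
Qed.

Let Sup_Slo : (Sup <= Slo + lam * fine (leb2 B) / N1)%R.
Proof.
rewrite -sum_mu mulr_suml -big_split /=; apply: ler_sum => j _.
by rewrite -mulrDr; apply: ler_wpM2l; [exact: mu_ge0|exact: up_lo].
Qed.

Let Slo_Sup : (0 <= Slo <= Sup)%R.
Proof.
apply/andP; split.
  by apply: sumr_ge0 => j _; rewrite mulr_ge0 //; have /andP[] := lo01 j.
apply: ler_sum => j _; rewrite ler_wpM2l //.
by rewrite /lo /up le_min !ge_min lexx orbT andbT ler_pM2r ?invr_gt0 // ler_nat leqnSn.
Qed.

Let E := \int[P]_w (infprod (fun i => 1 - p (x i w)))%:E.
Let I := \int[leb2]_(u in B) (p u)%:E.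

Let q01 u : (0 <= 1 - p u <= 1)%R.
Proof. by have /andP[p0 p1] := p01 u; rewrite subr_ge0 p1 gerBl. Qed.

Let mq : measurable_fun setT (fun u => 1 - p u)%R.
Proof. exact: measurable_funB. Qed.

Let g01 q u : (forall j, (0 <= q j <= 1)%R) -> (0 <= g q u <= 1)%R.
Proof.
move=> H; have [Bu|nB] := pselect (B u); last by rewrite gNB // ler01 lexx.
by rewrite gB //; have /andP[p0 p1] := H (idx u); rewrite subr_ge0 p1 gerBl.
Qed.

Let mg q : measurable_fun setT (g q).
Proof.
apply: measurable_prod => j _.
rewrite (_ : (fun w => _) = (fun w => 1 - q j * \1_(A j) w)%R).
  by apply: measurable_funB => //; apply: measurable_funM.
apply/funext => w; rewrite indicE; case: (_ \in _); by rewrite ?mulr1 // mulr0 subr0.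
Qed.

Let E_bounds : (expR (- Sup))%:E <= E <= (expR (- Slo))%:E.
Proof.
rewrite /Sup /Slo -!pgfl_step //; apply/andP; split; apply: ge0_le_integral => //.
- by move=> w _; rewrite lee_fin; have /andP[] := infprod_01 (fun i => g up (x i w)) (fun i => g01 up (x i w) up01).
- by apply/measurable_EFinP; exact: (measurable_infprod _ (mg up) (fun u => g01 up u up01)).
- by apply/measurable_EFinP; exact: (measurable_infprod _ mq q01).
- move=> w _; rewrite lee_fin; apply: le_infprod => i; last by have /andP[] := q01 (x i w).
  have /andP[-> _] := g01 up (x i w) up01.
  have [Bu|nB] := pselect (B (x i w)); last by rewrite gNB // pB // subr0 lexx.
  by rewrite gB // lerD2l lerN2 p_up.
- by move=> w _; rewrite lee_fin; have /andP[] := infprod_01 _ (fun i => q01 (x i w)).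
- by apply/measurable_EFinP; exact: (measurable_infprod _ mq q01).
- by apply/measurable_EFinP; exact: (measurable_infprod _ (mg lo) (fun u => g01 lo u lo01)).
- move=> w _; rewrite lee_fin; apply: le_infprod => i; last by have /andP[] := g01 lo (x i w) lo01.
  have /andP[-> _] := q01 (x i w).
  have [Bu|nB] := pselect (B (x i w)); last by rewrite gNB // pB // subr0 lexx.
  by rewrite gB // lerD2l lerN2 lo_p.
Qed.

Let I_sum : I = \sum_(j < N.+2) \int[leb2]_(u in A j) (p u)%:E.
Proof.
rewrite /I [in LHS]BE -(big_mkord xpredT A) ge0_integral_bigsetU //=.
- by rewrite big_mkord.
- exact: (iota_uniq 0 N.+2).
- by apply/trivIsetP => i j _ _ /eqP ij; exact: tA.
- by apply/measurable_EFinP; exact: measurable_funTS.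
- by move=> u _; rewrite lee_fin; have /andP[] := p01 u.
Qed.

Let I_bounds : ((\sum_(j < N.+2) fine (leb2 (A j)) * lo j)%:E <= I <=
  (\sum_(j < N.+2) fine (leb2 (A j)) * up j)%:E).
Proof.
have cst_int j (c : R) : \int[leb2]_(u in A j) c%:E = (fine (leb2 (A j)) * c)%:E.
  have Af : leb2 (A j) \is a fin_num by rewrite ge0_fin_numE // Aoo.
  by rewrite (integral_cst leb2 (mA j) c%:E) EFinM (fineK Af) muleC.
have mpA j : measurable_fun (A j) (EFin \o p).
  by apply/measurable_EFinP; exact: measurable_funTS.
rewrite I_sum -!sumEFin; apply/andP; split; apply: lee_sum => j _; rewrite -cst_int;
  apply: ge0_le_integral => //.
- by move=> u _; rewrite lee_fin; have /andP[] := lo01 j.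
- by move=> u /A_idx <-; rewrite lee_fin.
- by move=> u _; rewrite lee_fin; have /andP[] := p01 u.
- by move=> u /A_idx <-; rewrite lee_fin.
Qed.

(** Replacing [p] by its step bounds puts both quantities between [expR (- Sup)] and [expR (- Slo)].
    The bands have height [1 / N.+1], so [Sup - Slo] is at most the right-hand side. *)
Lemma pgfl_approx :
  (`| fine E - expR (- (lam * fine I)) | <= lam * fine (leb2 B) / N.+1%:R)%R.
Proof.
have /andP[E1 E2] := E_bounds; have /andP[I1 I2] := I_bounds.
have Efin : E \is a fin_num.
  by rewrite fin_numE -ltNye -ltey (lt_le_trans _ E1) ?ltNyr // (le_lt_trans E2) ?ltry.
have Ifin : I \is a fin_num.
  by rewrite fin_numE -ltNye -ltey (lt_le_trans _ I1) ?ltNyr // (le_lt_trans I2) ?ltry.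
move: E1 E2 I1 I2; rewrite -{1 2}(fineK Efin) -{1 2}(fineK Ifin) !lee_fin => E1 E2 I1 I2.
have SE f : (\sum_(j < N.+2) mu j * f j = lam * \sum_(j < N.+2) fine (leb2 (A j)) * f j)%R.
  by rewrite mulr_sumr; apply: eq_bigr => j _; rewrite /mu mulrA.
have J1 : (Slo <= lam * fine I)%R by rewrite /Slo SE ler_wpM2l // ltW.
have J2 : (lam * fine I <= Sup)%R by rewrite /Sup SE ler_wpM2l // ltW.
have K1 : (expR (- Sup) <= expR (- (lam * fine I)))%R by rewrite ler_expR lerN2.
have K2 : (expR (- (lam * fine I)) <= expR (- Slo))%R by rewrite ler_expR lerN2.
have /andP[S0 S1] := Slo_Sup.
have L := expRN_lip _ _ S0 S1.
apply: (@sandwich_dist R (expR (- Sup)) (expR (- Slo))) => //.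
by apply: (le_trans L); rewrite lerBlDl; exact: Sup_Slo.
Qed.

End Grid.

(** [pgfl_approx] holds for every [N], and its right-hand side tends to 0. *)
Lemma pgfl (p : R * R -> R) (B : set (R * R)) :
  measurable B -> leb2 B < +oo -> measurable_fun setT p ->
  (forall u, (0 <= p u <= 1)%R) -> (forall u, ~ B u -> p u = 0%R) ->
  \int[P]_w (infprod (fun i => 1 - p (x i w)))%:E =
  (expR (- (lam * fine (\int[leb2]_(u in B) (p u)%:E))))%:E.
Proof.
move=> mB Boo mp p01 pB.
have q01 u : (0 <= 1 - p u <= 1)%R.
  by have /andP[p0 p1] := p01 u; rewrite subr_ge0 p1 gerBl.
have mq : measurable_fun setT (fun u => 1 - p u)%R by exact: measurable_funB.
have mX := measurable_infprod _ mq q01.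
set E := LHS.
have E0 : 0 <= E.
  by apply: integral_ge0 => w _; rewrite lee_fin; have /andP[] := infprod_01 _ (fun i => q01 (x i w)).
have E1 : E <= 1.
  apply: (@le_trans _ _ (\int[P]_w (cst 1 w))).
    apply: ge0_le_integral => //.
    - by move=> w _; rewrite lee_fin; have /andP[] := infprod_01 _ (fun i => q01 (x i w)).
    - exact/measurable_EFinP.
    - by move=> w _; rewrite lee_fin; have /andP[] := infprod_01 _ (fun i => q01 (x i w)).
  by rewrite integral_cst //= probability_setT mule1.
have Efin : E \is a fin_num by rewrite ge0_fin_numE // (le_lt_trans E1) ?ltry.
rewrite -(fineK Efin); congr EFin.
set e := expR _; set D := (lam * fine (leb2 B))%R.
have H N : (`| fine E - e | <= D / N.+1%:R)%R by exact: pgfl_approx.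
have D0 : (0 <= D)%R by rewrite mulr_ge0 ?fine_ge0 // ltW.
apply/eqP; rewrite -subr_eq0 -normr_eq0 eq_le normr_ge0 andbT leNgt; apply/negP => pos.
(* With this [N], the bound [D / N.+1] is smaller than the supposed positive distance. *)
have := H (Num.truncn (D / `|fine E - e|)%R).
rewrite ler_pdivlMr // leNgt => /negP; apply.
by rewrite mulrC -ltr_pdivrMr // truncnS_gt.
Qed.

End GeneratingFunctional.

(** * Void probabilities of the process of squared distances *)

Lemma cvg_forall_lt {R : realType} {d : measure_display} {T : measurableType d}
    (P : probability T R) (B : nat -> set T) :
  (forall j, measurable (B j)) ->
  (P [set w | forall j, (j < m)%N -> B j w] @[m --> \oo] -->
  P [set w | forall j, B j w])%E.
Proof.
move=> mB.
pose F m := [set w | forall j, (j < m)%N -> B j w].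
have -> : [set w | forall j, B j w] = \bigcap_m F m.
  apply/seteqP; split => w /=; first by move=> H m _ j _.
  by move=> H j; exact: (H j.+1 I j).
apply: (nonincreasing_cvg_mu (F := F)).
- by apply: (le_lt_trans (probability_le1 P _)); [exact: measurable_forall_lt|rewrite ltry].
- by move=> m; exact: measurable_forall_lt.
- by apply: bigcapT_measurable => m; exact: measurable_forall_lt.
- move=> m n mn; apply/subsetPset => w /= H j jm.
  by apply: H; exact: leq_trans mn.
Qed.

Section VoidProbabilities.
Context {R : realType} {d : measure_display} {T : measurableType d}.
Local Open Scope ereal_scope.

Variables (lam rho r : R) (L : set (R * R)).
Hypotheses (lam0 : (0 < lam)%R) (mL : measurable L)
  (Lr : forall u phi, L (sqdists rho (u, phi)) -> square r u).

(** Direction 0 stands for all directions, by [leb2_sqdists]. *)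
Definition void_value : \bar R :=
  (expR (- (lam * fine (leb2 [set u : R * R | L (sqdists rho (u, 0%R))]))))%:E.

Let D : set ((R * R) * R) := sqdists rho @^-1` L.

Let mD : measurable D.
Proof. by rewrite /D -[X in measurable X]setTI; exact: measurable_sqdists. Qed.

Let DphiE phi : leb2 (ysection D phi) = leb2 [set u | L (sqdists rho (u, 0%R))].
Proof.
rewrite -(leb2_sqdists rho phi rho 0%R L) //; congr leb2.
by rewrite ysectionE.
Qed.

Let D0oo : leb2 [set u | L (sqdists rho (u, 0%R))] < +oo.
Proof.
apply: (le_lt_trans _ (leb2_square r)).
apply: le_measure; rewrite ?inE //; last by move=> u; exact: Lr.
  have := measurable_ysection (0 : R)%R mD; by rewrite ysectionE.
exact: measurable_square.
Qed.

(** For a fixed direction [phi] the event is that the Poisson process misses the section of [D] at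
    [phi]. The area of this section is the same for all [phi], so averaging over the direction
    changes nothing. *)
Lemma terrestrial_void (P : probability T R) (y : nat -> T -> R * R) (th : T -> R) :
  terrestrial_model P lam y th ->
  P [set w | forall i, ~ L (sqdists rho (y i w, th w))] = void_value.
Proof.
move=> model; have [PPPy [mth _]] := model.
have my := PPPy.1.
have mDC : measurable (~` D) by exact: measurableC.
pose Q : probability (T * R)%type R := (P \x angle_prob).
pose G := [set u : T * R | forall i, (~` D) (y i u.1, u.2)].
have mGi i : measurable [set u : T * R | (~` D) (y i u.1, u.2)].
  rewrite -[X in measurable X]setTI.
  have m : measurable_fun setT (fun u : T * R => (y i u.1, u.2)).
    by apply: measurable_fun_pair => //; apply: (measurableT_comp (my i)).
  exact: m.
have mG : measurable G.
  rewrite (_ : G = \bigcap_i [set u : T * R | (~` D) (y i u.1, u.2)]).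
    by apply: bigcapT_measurable.
  by apply/seteqP; split => w H i //; [move=> _; exact: H|exact: H i I].
(* [terrestrial_joint] treats finitely many stations; continuity from above on both sides gives all
   of them. *)
have -> : P [set w | forall i, ~ L (sqdists rho (y i w, th w))] = Q G.
  have c1 : P [set w | forall j, (j < m)%N -> [set w | (~` D) (y j w, th w)] w] @[m --> \oo] -->
      P [set w | forall j, [set w | (~` D) (y j w, th w)] w].
    apply: cvg_forall_lt => j; rewrite -[X in measurable X]setTI.
    have m : measurable_fun setT (fun w => (y j w, th w)) by exact: measurable_fun_pair.
    exact: m.
  have c2 := cvg_forall_lt Q (fun j => [set u : T * R | (~` D) (y j u.1, u.2)]) mGi.
  apply: (cvg_unique _ c1) => //.
  rewrite (_ : (fun m => P _) =
    fun m => Q [set u | forall j, (j < m)%N -> (~` D) (y j u.1, u.2)]); first exact: c2.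
  apply/funext => m; exact: (terrestrial_joint P lam y th model m (fun=> ~` D)).
(* In this order of integration the direction is fixed first. *)
transitivity ((P \x^ angle_prob) G).
  by apply: product_measure_unique => // B C mB mC; rewrite /= product_measure2E.
rewrite /product_measure2 /=.
transitivity (\int[@angle_prob R]_phi (cst void_value phi)).
  apply: eq_integral => phi _ /=.
  rewrite ysectionE /void_value -(DphiE phi).
  rewrite -(prob_void P lam y PPPy); last first.
  - by rewrite DphiE.
  - exact: measurable_ysection.
  by congr (P _); apply/seteqP; split => w /= H i; move: (H i); rewrite ysectionE.
by rewrite integral_cst //= probability_setT mule1.
Qed.

(** Given the positions, a station at [u] avoids [L] with probability [1 - p u], so the void
    probability is the generating functional at [p]. By Tonelli, the integral of [p] is the average
    over directions of the area of the sections of [D], and this area is constant. *)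
Lemma aerial_void (P : probability T R) (z : nat -> T -> R * R) (ph : nat -> T -> R) :
  aerial_model P lam z ph ->
  P [set w | forall i, ~ L (sqdists rho (z i w, ph i w))] = void_value.
Proof.
move=> model; have [PPPz [mph _]] := model.
have mz := PPPz.1.
have mDC : measurable (~` D) by exact: measurableC.
pose p (u : R * R) := fine (angle_prob (xsection D u)).
have xfin (S : set ((R * R) * R)) u : measurable S -> angle_prob (xsection S u) \is a fin_num.
  by move=> mS; apply: fin_num_measure; exact: measurable_xsection.
have p01 u : (0 <= p u <= 1)%R.
  rewrite /p fine_ge0 //= -lee_fin fineK; last exact: xfin.
  by apply: probability_le1; exact: measurable_xsection.
have mp : measurable_fun setT p.
  apply: (@measurableT_comp _ _ _ _ _ _ fine) => //.
  exact: measurable_fun_xsection.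
have pC u : fine (angle_prob (xsection (~` D) u)) = (1 - p u)%R.
  have -> : xsection (~` D) u = ~` xsection D u by rewrite !xsectionE preimage_setC.
  have -> : angle_prob (~` xsection D u) = 1 - angle_prob (xsection D u).
    by apply: probability_setC; exact: measurable_xsection.
  by rewrite fineB // xfin.
have pr u : ~ square r u -> p u = 0%R.
  move=> nr; rewrite /p (_ : xsection D u = set0) ?measure0 //.
  by rewrite xsectionE; apply/seteqP; split => // phi /= /Lr.
have q01 u : (0 <= 1 - p u <= 1)%R.
  by have /andP[p0 p1] := p01 u; rewrite subr_ge0 p1 gerBl.
have mq : measurable_fun setT (fun u => 1 - p u)%R by exact: measurable_funB.
transitivity (\int[P]_w (infprod (fun i => 1 - p (z i w)))%:E).
  have c1 : P [set w | forall j, (j < m)%N -> [set w | (~` D) (z j w, ph j w)] w] @[m --> \oo] -->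
      P [set w | forall j, [set w | (~` D) (z j w, ph j w)] w].
    apply: cvg_forall_lt => j; rewrite -[X in measurable X]setTI.
    have m : measurable_fun setT (fun w => (z j w, ph j w)) by exact: measurable_fun_pair.
    exact: m.
  apply: (cvg_unique _ c1) => //.
  rewrite (_ : (fun m => P _) = fun m => \int[P]_w (\prod_(i < m) (1 - p (z i w)))%:E); last first.
    apply/funext => m; rewrite (aerial_joint P lam z ph model m (fun=> ~` D)) //.
    by apply: eq_integral => w _; congr EFin; apply: eq_bigr => i _; exact: pC.
  (* The partial products are dominated by 1, which allows infinitely many stations. *)
  apply: (@dominated_cvg _ _ _ P setT measurableT _ _ (cst 1)) => //.
  - move=> m; apply/measurable_EFinP; apply: measurable_prod => i _.
    exact: (measurableT_comp mq (mz i)).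
  - move=> w _; apply: cvg_EFin; first by apply: nearW.
    by apply: is_cvg_infprod => i; exact: q01.
  - exact: finite_measure_integrable_cst.
  - move=> m w _ /=; rewrite lee_fin ger0_norm.
      by apply: prodr_ile1 => i _; exact: q01.
    by apply: prodr_ge0 => i _; have /andP[] := q01 (z i w).
rewrite (pgfl P lam z lam0 PPPz p (square r)) //; last 2 first.
- exact: measurable_square.
- exact: leb2_square.
rewrite /void_value; congr (expR (- (lam * fine _)))%:E.
transitivity (\int[leb2]_u (angle_prob (xsection D u))).
  rewrite integral_mkcond; apply: eq_integral => u _; rewrite patchE.
  case: ifPn => [_|]; first by rewrite /p fineK // xfin.
  by rewrite notin_setE => /pr p0; rewrite -[RHS]fineK ?xfin // -/(p u) p0.
(* Exchanges the integrals over position and direction for the indicator of [D]. *)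
have := indic_fubini_tonelli leb2 angle_prob mD.
rewrite indic_fubini_tonelli_FE // indic_fubini_tonelli_GE // => /= ->.
transitivity (\int[@angle_prob R]_phi (cst (leb2 [set u | L (sqdists rho (u, 0%R))]) phi)).
  by apply: eq_integral => phi _ /=; exact: DphiE.
by rewrite integral_cst //= probability_setT mule1.
Qed.

End VoidProbabilities.

(** * Minimisers of locally finite sequences and their discretisation *)

Section LocallyFiniteSequences.
Context {R : realType}.
Implicit Types a c : nat -> R.

Definition locally_finite a := forall r, exists M, forall i, a i < r -> (i < M)%N.

Definition argmins a : set nat := [set i | forall j, a i <= a j].

Definition level (n : nat) (u : R) : nat := Num.truncn (u * n.+1%:R).

Definition argmin_levels (n : nat) a : set nat :=
  [set i | forall j, (level n (a i) <= level n (a j))%N].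

Lemma le_level n : {homo level n : u v / u <= v >-> (u <= v)%N}.
Proof. by move=> u v uv; apply: le_truncn; rewrite ler_pM2r // ltr0n. Qed.

Lemma argmins_nonempty a : locally_finite a -> exists i, argmins a i.
Proof.
(* The margin 1 puts index 0 itself among the finitely many candidates. *)
move=> lf; have [M HM] := lf (a 0%N + 1).
have M0 : (0 < M)%N by apply: HM; rewrite ltrDl.
have [i _ Hi] := @arg_minP _ R 'I_M (Ordinal M0) xpredT (fun i => a i) isT.
exists i => j; case: (ltnP j M) => [jM|Mj]; first exact: (Hi (Ordinal jM)).
apply: (le_trans (Hi (Ordinal M0) isT)) => /=; rewrite leNgt; apply/negP => aj.
by move: Mj; rewrite leqNgt HM // (lt_trans aj) // ltrDl.
Qed.

(** Only finitely many terms lie within 1 of the minimum, so those that differ from it stay at a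
    positive distance. *)
Lemma argmins_gap a i0 : locally_finite a -> argmins a i0 ->
  exists2 e, 0 < e & forall j, a j = a i0 \/ a i0 + e <= a j.
Proof.
move=> lf ai0; have [M HM] := lf (a i0 + 1).
suff [e [e0 e1 He]] : exists e, [/\ 0 < e, e <= 1 &
    forall j, (j < M)%N -> a j = a i0 \/ a i0 + e <= a j].
  exists e => // j; case: (ltnP j M) => [|Mj]; first exact: He.
  right; rewrite leNgt; apply/negP => aj; move: Mj; rewrite leqNgt HM //.
  by apply: (lt_le_trans aj); rewrite lerD2l.
elim: M {HM} => [|M [e [e0 e1 He]]]; first by exists 1; split.
have [aM|aM] := eqVneq (a M) (a i0).
  exists e; split => // j; rewrite ltnS leq_eqVlt => /orP[/eqP->|]; [by left|exact: He].
have d0 : 0 < a M - a i0 by rewrite subr_gt0 lt_neqAle eq_sym aM ai0.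
exists (Num.min e (a M - a i0)); split => [||j].
- by rewrite lt_min e0.
- by rewrite ge_min e1.
rewrite ltnS leq_eqVlt => /orP[/eqP->|jM].
  by right; rewrite -lerBrDl ge_min lexx orbT.
have [->|h] := He j jM; first by left.
by right; apply: le_trans h; rewrite lerD2l ge_min lexx.
Qed.

(** Once the mesh [1 / n.+1] is at most the gap [e] above the minimum, every term that is not
    minimal has a strictly larger level than the minimum. *)
Lemma argmin_levels_eventually a : (forall i, 0 <= a i) -> locally_finite a ->
  exists N, forall n, (N <= n)%N -> argmin_levels n a = argmins a.
Proof.
move=> a0 lf; have [i0 ai0] := argmins_nonempty _ lf.
have [e e0 He] := argmins_gap _ _ lf ai0.
exists (Num.truncn e^-1) => n Nn; apply/seteqP; split => i /= Hi j; last first.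
  by apply: le_level; exact: Hi.
have n0 : 0 < n.+1%:R :> R by rewrite ltr0n.
have en : 1 <= e * n.+1%:R.
  rewrite mulrC -ler_pdivrMr // mul1r; apply/ltW/(lt_le_trans (truncnS_gt _)).
  by rewrite ler_nat ltnS.
suff -> : a i = a i0 by exact: ai0.
have [//|h] := He i; exfalso.
have := Hi i0; rewrite leqNgt => /negP; apply.
rewrite /level truncn_ge_nat; last by rewrite mulr_ge0 // ltW.
have h1 : (Num.truncn (a i0 * n.+1%:R))%:R <= a i0 * n.+1%:R.
  by rewrite truncn_le mulr_ge0 // ltW.
rewrite -natr1; apply: (le_trans (lerD h1 en)).
by rewrite -mulrDl ler_pM2r.
Qed.

Definition cell (n p q : nat) (u : R * R) := level n u.1 = p /\ level n u.2 = q.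

(** An L-shaped region whose inner corner is the cell [(p, q)]. If it contains some point and all
    its points are in that cell, then [p] and [q] are the minimal levels of the two coordinates. *)
Definition lowerset (n p q : nat) (u : R * R) :=
  (level n u.1 <= p)%N \/ (level n u.2 <= q)%N.

Definition rest (n p q : nat) : set (R * R) :=
  [set u | lowerset n p q u /\ ~ cell n p q u].

(* Expresses the coincidence of the minimisers through void events only. *)
Lemma argmin_levels_cell n (u : nat -> R * R) :
  argmin_levels n (fst \o u) = argmin_levels n (snd \o u) <->
  exists p q, (forall i, ~ rest n p q (u i)) /\ ~ (forall i, ~ lowerset n p q (u i)).
Proof.
pose A i := level n (u i).1; pose C i := level n (u i).2.
have exmin (B : nat -> nat) : exists i, forall j, (B i <= B j)%N.
  have h : exists k, [pred k | `[< exists i, B i = k >]] k.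
    by exists (B 0%N); apply/asboolP; exists 0%N.
  case: (ex_minnP h) => m /asboolP[i Bi] Hm; exists i => j.
  by rewrite Bi; apply: Hm; apply/asboolP; exists j.
split.
  (* The cell sought is that of any minimiser of the first levels, which by [E] also minimises the
     second ones. *)
  move=> E; have [i Ai] := exmin A.
  have Ci : argmin_levels n (snd \o u) i by rewrite -E.
  exists (A i), (C i); split; last first.
    by move=> /(_ i); apply; left; rewrite leqnn.
  move=> j [[Aj|Cj] ncell]; apply: ncell.
    have Aji : A j = A i by apply/eqP; rewrite eqn_leq Aj Ai.
    have : argmin_levels n (fst \o u) j by move=> k /=; rewrite -/(A j) Aji; exact: Ai.
    rewrite E => Cj; split => //; apply/eqP.
    by rewrite eqn_leq (Cj i) (Ci j).
  have Cji : C j = C i by apply/eqP; rewrite eqn_leq Cj; exact: Ci.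
  have : argmin_levels n (snd \o u) j.
    by move=> k /=; rewrite -/(C j) Cji; exact: Ci.
  rewrite -E => Aj; split => //; apply/eqP.
  by rewrite eqn_leq (Aj i) Ai.
move=> [p [q [nrest /existsNP[i0 /contrapT lo0]]]].
have K j : lowerset n p q (u j) -> cell n p q (u j).
  by move=> lj; apply: contrapT => ncell; apply: (nrest j).
have [A0 C0] := K _ lo0.
have Amin j : (p <= A j)%N.
  rewrite leqNgt; apply/negP => h; have [Aj _] := K j (or_introl (ltnW h)).
  by move: h; rewrite /A Aj ltnn.
have Cmin j : (q <= C j)%N.
  rewrite leqNgt; apply/negP => h; have [_ Cj] := K j (or_intror (ltnW h)).
  by move: h; rewrite /C Cj ltnn.
apply/seteqP; split => i /= Hi j.
  have [_ ->] : cell n p q (u i) by apply: K; left; rewrite -A0; exact: Hi.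
  exact: Cmin.
have [-> _] : cell n p q (u i) by apply: K; right; rewrite -C0; exact: Hi.
exact: Amin.
Qed.

(** If [p <= p'], a point in the cell [(p, q)] belongs to the lower set of [(p', q')], hence to the
    cell [(p', q')] as well. *)
Lemma argmin_levels_cell_unique n (u : nat -> R * R) p q p' q' :
  (forall i, ~ rest n p q (u i)) -> ~ (forall i, ~ lowerset n p q (u i)) ->
  (forall i, ~ rest n p' q' (u i)) -> ~ (forall i, ~ lowerset n p' q' (u i)) ->
  (p, q) = (p', q').
Proof.
wlog pp' : p q p' q' / (p <= p')%N => [wl|].
  move=> h1 h2 h3 h4; have [pp'|/ltnW p'p] := leqP p p'; first exact: wl.
  by apply/esym; exact: wl.
move=> nr /existsNP[i /contrapT li] nr' _.
have [Ai Ci] : cell n p q (u i) by apply: contrapT => nc; exact: (nr i).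
have [<- <-] : cell n p' q' (u i).
  by apply: contrapT => nc; apply: (nr' i); split => //; left; rewrite Ai.
by rewrite Ai Ci.
Qed.

Lemma measurable_level_le n p : measurable [set u : R | (level n u <= p)%N].
Proof.
rewrite (_ : [set u | _] = `]-oo, (p.+1%:R / n.+1%:R)[%classic).
  exact: measurable_itv.
by apply/seteqP; split => u /=; rewrite in_itv /= ltr_pdivlMr ?ltr0n // truncn_le_nat.
Qed.

Lemma measurable_level_eq n p : measurable [set u : R | level n u = p].
Proof.
case: p => [|p].
  rewrite (_ : [set u | _] = [set u : R | (level n u <= 0)%N]); first exact: measurable_level_le.
  by apply/seteqP; split => u /=; [move=> ->|rewrite leqn0 => /eqP].
rewrite (_ : [set u | _] = [set u : R | (level n u <= p.+1)%N] `\` [set u | (level n u <= p)%N]).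
  by apply: measurableD; exact: measurable_level_le.
apply/seteqP; split => u /=; first by move=> ->; rewrite leqnn ltnn.
by move=> [h /negP]; rewrite -ltnNge => h'; apply/eqP; rewrite eqn_leq h.
Qed.

Lemma measurable_fst_set (S : set R) : measurable S -> measurable [set u : R * R | S u.1].
Proof. by move=> mS; rewrite -[X in measurable X]setTI; exact: measurable_fst. Qed.

Lemma measurable_snd_set (S : set R) : measurable S -> measurable [set u : R * R | S u.2].
Proof. by move=> mS; rewrite -[X in measurable X]setTI; exact: measurable_snd. Qed.

Lemma measurable_lowerset n p q : measurable (lowerset n p q).
Proof.
by apply: measurableU; [apply: (measurable_fst_set [set u | (level n u <= p)%N])|
  apply: (measurable_snd_set [set u | (level n u <= q)%N])]; exact: measurable_level_le.
Qed.

Lemma measurable_cell n p q : measurable (cell n p q).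
Proof.
by apply: measurableI; [apply: (measurable_fst_set [set u | level n u = p])|
  apply: (measurable_snd_set [set u | level n u = q])]; exact: measurable_level_eq.
Qed.

Lemma measurable_rest n p q : measurable (rest n p q).
Proof.
apply: (measurableI (lowerset n p q) (~` cell n p q)); first exact: measurable_lowerset.
by apply: measurableC; exact: measurable_cell.
Qed.

End LocallyFiniteSequences.

(** * The probability that both coordinates have the same minimisers *)

Section MinimaEvent.
Context {R : realType} {d : measure_display} {T : measurableType d}.
Variable P : probability T R.
Local Open Scope ereal_scope.

(** Dominated convergence for the indicators, which almost surely become stationary. *)
Lemma cvg_prob_eventually (S : nat -> set T) (G : set T) :
  (forall n, measurable (S n)) -> measurable G ->
  {ae P, forall w, exists N, forall n, (N <= n)%N -> (S n w <-> G w)} ->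
  P (S n) @[n --> \oo] --> P G.
Proof.
move=> mS mG H.
have PE A : measurable A -> P A = \int[P]_w (\1_A w)%:E.
  by move=> mA; rewrite integral_indic // setIT.
rewrite (PE G mG) (_ : (fun n => P (S n)) = fun n => \int[P]_w (\1_(S n) w)%:E); last first.
  by apply/funext => n; exact: PE.
have mI (A : set T) : measurable A -> measurable_fun setT (fun w => (\1_A w : R)%:E).
  by move=> mA; apply/measurable_EFinP; exact: measurable_indic.
have [] // := @dominated_convergence _ _ _ P setT measurableT
  (fun n w => (\1_(S n) w)%:E) (fun w => (\1_G w)%:E) (cst 1)
  (fun n => mI _ (mS n)) (mI _ mG).
- apply: filterS H => w [N HN] _.
  apply: cvg_near_cst; exists N => // n /= Nn.
  rewrite !indicE; congr (_%:R%:E); congr nat_of_bool.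
  by apply/idP/idP; rewrite !inE => /(HN n Nn).
- exact: finite_measure_integrable_cst.
- apply: aeW => w n _; rewrite lee_fin ger0_norm //.
Qed.

Variable pt : nat -> T -> R * R.
Hypothesis mpt : forall i, measurable_fun setT (pt i).

Definition same_levels (n : nat) : set T :=
  [set w | argmin_levels n (fst \o pt^~ w) = argmin_levels n (snd \o pt^~ w)].

Definition void (L : set (R * R)) : set T := [set w | forall i, ~ L (pt i w)].

Lemma measurable_void L : measurable L -> measurable (void L).
Proof.
move=> mL; rewrite (_ : void L = \bigcap_i ~` (pt i @^-1` L)).
  apply: bigcapT_measurable => i; apply: measurableC.
  by rewrite -[_ @^-1` _]setTI; exact: mpt.
by apply/seteqP; split => w H i //; [move=> _; exact: H|exact: H i I].
Qed.

(** The pairs [(p, q)] are enumerated by their codes to get a union indexed by [nat]; numbers that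
    code no pair contribute the empty event. *)
Definition cell_event (n k : nat) : set T :=
  if pickle_inv k is Some (p, q)
  then void (rest n p q) `\` void (lowerset n p q) else set0.

Lemma measurable_cell_event n k : measurable (cell_event n k).
Proof.
rewrite /cell_event; case: pickle_inv => [[p q]|//].
apply: measurableD; apply: measurable_void; first exact: measurable_rest.
exact: measurable_lowerset.
Qed.

Lemma same_levelsE n : same_levels n = \bigcup_k cell_event n k.
Proof.
apply/seteqP; split => w /=.
  move=> /argmin_levels_cell[p [q [h1 h2]]].
  by exists (pickle (p, q)) => //; rewrite /cell_event pickleK_inv.
move=> [k _]; rewrite /cell_event; case: pickle_inv => [[p q] [h1 h2]|//].
by apply/argmin_levels_cell; exists p, q.
Qed.

Lemma trivIset_cell_event n : trivIset setT (cell_event n).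
Proof.
apply/trivIsetP => k k' _ _ kk'; apply/seteqP; split => // w [].
rewrite /cell_event.
have := @pickle_invK (nat * nat)%type k; have := @pickle_invK (nat * nat)%type k'.
case: (pickle_inv k) => [[p q]|//]; case: (pickle_inv k') => [[p' q']|//] /= h' h.
move=> [a1 a2] [b1 b2]; move: kk'; rewrite -h -h'.
by rewrite (argmin_levels_cell_unique n (pt^~ w) p q p' q' a1 a2 b1 b2) eqxx.
Qed.

(** The probability of [cell_event] in terms of void probabilities: as [rest] is contained in
    [lowerset], the void events are nested the other way. *)
Definition cell_value (V : set (R * R) -> \bar R) (n k : nat) : \bar R :=
  if pickle_inv k is Some (p, q) then V (rest n p q) - V (lowerset n p q) else 0.

Lemma prob_same_levels (V : set (R * R) -> \bar R) n :
  (forall p q, P (void (rest n p q)) = V (rest n p q)) ->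
  (forall p q, P (void (lowerset n p q)) = V (lowerset n p q)) ->
  P (same_levels n) = \sum_(0 <= k <oo) cell_value V n k.
Proof.
move=> V1 V2; rewrite same_levelsE measure_semi_bigcup //.
- apply: eq_eseriesr => k _; rewrite /cell_event /cell_value.
  case: pickle_inv => [[p q]|]; last by rewrite measure0.
  rewrite -V1 -V2 measureD.
  + congr (_ - P _); apply/seteqP; split => w; first by case.
    by move=> h; split => // i [li _]; exact: (h i).
  + by apply: measurable_void; exact: measurable_rest.
  + by apply: measurable_void; exact: measurable_lowerset.
  + apply: (le_lt_trans (probability_le1 P _)); last by rewrite ltry.
    by apply: measurable_void; exact: measurable_rest.
- by move=> k; exact: measurable_cell_event.
- exact: trivIset_cell_event.
- by apply: bigcup_measurable => k _; exact: measurable_cell_event.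
Qed.

(** The sequence on the left depends on the process only through [V], so two processes with the same
    void probabilities give [G] the same probability. *)
Lemma cvg_prob_argmins (V : set (R * R) -> \bar R) (G : set T) :
  (forall n p q, P (void (rest n p q)) = V (rest n p q)) ->
  (forall n p q, P (void (lowerset n p q)) = V (lowerset n p q)) ->
  measurable G ->
  (forall i w, (0 <= (pt i w).1)%R /\ (0 <= (pt i w).2)%R) ->
  {ae P, forall w, [/\ locally_finite (fst \o pt^~ w), locally_finite (snd \o pt^~ w) &
    (G w <-> argmins (fst \o pt^~ w) = argmins (snd \o pt^~ w))]} ->
  \sum_(0 <= k <oo) cell_value V n k @[n --> \oo] --> P G.
Proof.
move=> V1 V2 mG pt0 H.
rewrite (_ : (fun n => _) = fun n => P (same_levels n)); last first.
  by apply/funext => n; rewrite (prob_same_levels V).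
apply: cvg_prob_eventually => //.
  move=> n; rewrite same_levelsE; apply: bigcup_measurable => k _.
  exact: measurable_cell_event.
apply: filterS H => w [lf1 lf2 HG].
have [N1 H1] := argmin_levels_eventually _ (fun i => (pt0 i w).1) lf1.
have [N2 H2] := argmin_levels_eventually _ (fun i => (pt0 i w).2) lf2.
exists (maxn N1 N2) => n; rewrite geq_max => /andP[n1 n2].
by rewrite HG /same_levels /= H1 // H2.
Qed.

End MinimaEvent.

(** * Boundedness and local finiteness of squared distances *)

Section SquaredDistances.
Context {R : realType}.

Lemma sqr_lt_norm (x r : R) : x ^+ 2 < r -> `|x| <= `|r| + 1.
Proof.
move=> h; have h1 := ler_norm r; have h2 := normr_ge0 r; have h3 := normr_ge0 x.
rewrite leNgt; apply/negP => h4; move: h; rewrite -real_normK ?num_real //; nra.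
Qed.

Lemma sqdists_square (rho r : R) : exists r', forall u phi,
  (sqdists rho (u, phi)).1 < r \/ (sqdists rho (u, phi)).2 < r -> square r' u.
Proof.
(* [|r| + 1] bounds each coordinate of a position with squared norm below [r]; [|rho|] accounts for
   the displacement. *)
exists (`|r| + 1 + `|rho|) => -[x y] phi H.
suff [h1 h2] : `|x| <= `|r| + 1 + `|rho| /\ `|y| <= `|r| + 1 + `|rho|.
  by rewrite /square /= !in_itv /= -!ler_norml h1 h2.
have r0 := normr_ge0 rho.
case: H => /=; rewrite /sqdists /= => H.
  have h1 := sqr_ge0 x; have h2 := sqr_ge0 y.
  have hx : x ^+ 2 < r by lra.
  have hy : y ^+ 2 < r by lra.
  have := sqr_lt_norm _ _ hx; have := sqr_lt_norm _ _ hy.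
  by split; lra.
have h1 := sqr_ge0 (x + rho * cos phi); have h2 := sqr_ge0 (y + rho * sin phi).
have hx : (x + rho * cos phi) ^+ 2 < r by lra.
have hy : (y + rho * sin phi) ^+ 2 < r by lra.
have kx := sqr_lt_norm _ _ hx; have ky := sqr_lt_norm _ _ hy.
have c1 : `|rho * cos phi| <= `|rho|.
  by rewrite normrM ler_piMr // ler_norml cos_geN1 cos_le1.
have s1 : `|rho * sin phi| <= `|rho|.
  by rewrite normrM ler_piMr // ler_norml sin_geN1 sin_le1.
split.
  have -> : x = (x + rho * cos phi) - rho * cos phi by ring.
  by apply: (le_trans (ler_normB _ _)); exact: lerD.
have -> : y = (y + rho * sin phi) - rho * sin phi by ring.
by apply: (le_trans (ler_normB _ _)); exact: lerD.
Qed.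

Lemma level_le_lt (n p : nat) (u : R) : (level n u <= p)%N -> u < p.+1%:R / n.+1%:R.
Proof. by rewrite /level truncn_le_nat ltr_pdivlMr ?ltr0n. Qed.

Lemma lowerset_square (rho : R) (n p q : nat) : exists r, forall u phi,
  lowerset n p q (sqdists rho (u, phi)) -> square r u.
Proof.
have [r Hr] := sqdists_square rho (Num.max (p.+1%:R / n.+1%:R) (q.+1%:R / n.+1%:R)).
exists r => u phi H; apply: (Hr u phi); case: H => /level_le_lt h; [left|right];
  by rewrite lt_max h ?orbT.
Qed.

Lemma square_mono (r r' : R) : r <= r' -> square r `<=` square r'.
Proof.
move=> rr' -[x y]; rewrite /square /= !in_itv /= -!ler_norml => -[h1 h2].
by split; [exact: le_trans rr'|exact: le_trans rr'].
Qed.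

Lemma locally_finite_sqdists {d} {T : measurableType d} (rho : R)
    (x : nat -> T -> R * R) (phi : nat -> R) (w : T) :
  (forall m : nat, exists k : nat, count x (square m%:R) w = (k%:R)%:E) ->
  locally_finite (fst \o fun i => sqdists rho (x i w, phi i)) /\
  locally_finite (snd \o fun i => sqdists rho (x i w, phi i)).
Proof.
move=> H.
have gen r : exists M, forall i, square r (x i w) -> (i < M)%N.
  have [k /count_finite[M HM]] := H (Num.truncn r).+1.
  exists M => i h; apply: HM; apply: square_mono h; apply: ltW; exact: truncnS_gt.
split => r; have [r' Hr'] := sqdists_square rho r; have [M HM] := gen r';
  exists M => i /= h; apply: HM; apply: (Hr' _ (phi i)); [left|right]; exact: h.
Qed.

(** Squares with integer [m] exhaust the plane and involve only countably many null sets. *)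
Lemma ae_count_finite {d} {T : measurableType d} (P : probability T R) (lam : R)
    (x : nat -> T -> R * R) : 0 < lam -> is_PPP P lam x ->
  {ae P, forall w, forall m : nat, exists k : nat,
    count x (square m%:R) w = (k%:R)%:E}.
Proof.
move=> lam0 PPPx; apply/ae_foralln => m.
exists [set w | forall k, count x (square m%:R) w <> (k%:R)%:E]; split.
- rewrite (_ : [set w | _] =
      \bigcap_k ~` [set w | count x (square m%:R) w = (k%:R)%:E]).
    apply: bigcapT_measurable => k; apply: measurableC.
    by apply: (measurable_count_eq P lam x PPPx); exact: measurable_square.
  by apply/seteqP; split => w h k //; [move=> _; exact: h|exact: h k I].
- by apply: (count_finite_ae P lam x lam0 PPPx); [exact: measurable_square|exact: leb2_square].
- by move=> w /= /forallNP.
Qed.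

End SquaredDistances.

(** * Handover events and equality of their probabilities *)

Section Handover.
Context {R : realType} {d : measure_display} {T : measurableType d}.

(* All stations move at the same speed, so up to the common term [K s] the
   squared distances are affine in time: a station nearest at times 0 and [t]
   is nearest in between. *)
Lemma no_handoverE (dist : nat -> R -> T -> R) (t : R) (w : T) (a c : nat -> R) (K : R -> R) :
  0 < t ->
  (forall i s, 0 <= (1 - s / t) * a i + s / t * c i + K s) ->
  (forall i s, dist i s w = Num.sqrt ((1 - s / t) * a i + s / t * c i + K s)) ->
  (exists i, argmins a i) ->
  ~ handover dist t w <-> argmins a = argmins c.
Proof.
move=> t0 f0 distE [i0 ai0].
have le_dist i j s : (dist i s w <= dist j s w) =
    ((1 - s / t) * a i + s / t * c i <= (1 - s / t) * a j + s / t * c j).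
  by rewrite !distE ler_sqrt ?f0 // lerD2r.
have S0 : serving dist 0 w = argmins a.
  by apply/seteqP; split => i /= H j; have := H j; rewrite le_dist !(mul0r, subr0, mul1r, addr0).
have St : serving dist t w = argmins c.
  by apply/seteqP; split => i /= H j; have := H j;
    rewrite le_dist divff ?gt_eqF // subrr !(mul0r, add0r, mul1r).
split.
  move=> nH; rewrite -S0 -St; apply: contrapT => ne; apply: nH.
  by exists 0; split.
move=> E [s [s0 [st ne]]]; apply: ne; rewrite St -E.
have th0 : 0 <= s / t by rewrite divr_ge0 // ltW.
have th1 : 0 < 1 - s / t by rewrite subr_gt0 ltr_pdivrMr // mul1r.
apply/seteqP; split => i /= H; last first.
  move=> j; rewrite le_dist; apply: lerD.
    by rewrite ler_pM2l //; exact: H.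
  rewrite ler_wpM2l //; have : argmins c i by rewrite -E.
  exact.
(* If [i] is nearest at time [s], comparison with the common minimiser [i0] forces [a i <= a i0],
   because [s < t] makes the weight [1 - s / t] positive. *)
have ci0 : argmins c i0 by rewrite -E.
have := H i0; rewrite le_dist => Hi j.
have h1 : 0 <= s / t * (c i - c i0) by rewrite mulr_ge0 // subr_ge0 ci0.
suff : a i <= a i0 by move=> h; exact: le_trans (ai0 j).
rewrite -subr_le0 -(pmulr_rle0 _ th1); lra.
Qed.

End Handover.

Theorem theorem1 (R : realType) (lam0 v h : R)
  (hlam : 0 < lam0) (hv : 0 <= v) (hh : 0 < h)
  (d1 : measure_display) (T1 : measurableType d1) (P1 : probability T1 R)
  (y : nat -> T1 -> R * R) (th : T1 -> R)
  (d2 : measure_display) (T2 : measurableType d2) (P2 : probability T2 R)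
  (z : nat -> T2 -> R * R) (ph : nat -> T2 -> R) :
  terrestrial_model P1 lam0 y th ->
  aerial_model P2 lam0 z ph ->
  forall t : R, 0 <= t ->
  measurable (handover (dist_terr v y th) t) ->
  measurable (handover (dist_aer v h z ph) t) ->
  P1 (handover (dist_terr v y th) t) = P2 (handover (dist_aer v h z ph) t).
Proof.
move=> terr aer t; rewrite le_eqVlt => /orP[/eqP <-|t0] mH1 mH2.
  (* At time 0 there is no earlier time at which another station could have served. *)
  have no d (T : measurableType d) (dist : nat -> R -> T -> R) : handover dist 0 = set0.
    apply/seteqP; split => // w [s [s0 [s1 _]]].
    by move: (le_lt_trans s0 s1); rewrite ltxx.
  by rewrite !no !measure0.
have [PPPy [mth _]] := terr; have [PPPz [mph _]] := aer.
(* The moving UE sees static stations drift the opposite way, hence the sign. *)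
pose pt1 i w := sqdists (- (v * t)) (y i w, th w).
pose pt2 i w := sqdists (v * t) (z i w, ph i w).
pose V := void_value lam0 (v * t).
have Vsym L : measurable L -> void_value lam0 (- (v * t)) L = V L.
  move=> mL; rewrite /V /void_value (leb2_sqdists (- (v * t)) 0 (v * t) 0 L) //.
  by rewrite normrN.
have rest_square (rho : R) n p q : exists r, forall u phi,
    rest n p q (sqdists rho (u, phi)) -> square r u.
  have [r Hr] := lowerset_square rho n p q.
  by exists r => u phi [h1 _]; exact: Hr h1.
have mpt1 i : measurable_fun setT (pt1 i).
  apply: (measurableT_comp (measurable_sqdists _)).
  by apply: measurable_fun_pair => //; exact: PPPy.1.
have mpt2 i : measurable_fun setT (pt2 i).
  apply: (measurableT_comp (measurable_sqdists _)).
  by apply: measurable_fun_pair => //; exact: PPPz.1.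
have sq0 (rho : R) u : 0 <= (sqdists rho u).1 /\ 0 <= (sqdists rho u).2.
  by split; rewrite addr_ge0 ?sqr_ge0.
(* The probabilities of no handover in the two models are shown to be limits of one and the same
   sequence. *)
have c1 : (\sum_(0 <= k <oo) cell_value V n k @[n --> \oo] -->
    P1 (~` handover (dist_terr v y th) t))%E.
  apply: (cvg_prob_argmins P1 pt1 mpt1) => //.
  - move=> n p q; have [r Hr] := rest_square (- (v * t)) n p q.
    rewrite -Vsym; last exact: measurable_rest.
    exact: (terrestrial_void lam0 (- (v * t)) r (rest n p q)
      (measurable_rest n p q) Hr P1 y th terr).
  - move=> n p q; have [r Hr] := lowerset_square (- (v * t)) n p q.
    rewrite -Vsym; last exact: measurable_lowerset.
    exact: (terrestrial_void lam0 (- (v * t)) r (lowerset n p q)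
      (measurable_lowerset n p q) Hr P1 y th terr).
  - exact: measurableC.
  - move=> i w; exact: sq0.
  - apply: filterS (ae_count_finite P1 lam0 y hlam PPPy) => w Hw.
    have [lf1 lf2] := locally_finite_sqdists (- (v * t)) y (fun=> th w) w Hw.
    split => //.
    (* The squared distance is quadratic in [s] with leading coefficient [v ^+ 2] for every station,
       so it exceeds its affine interpolation between 0 and [t] by [v ^+ 2 * s * (s - t)]. *)
    have E i s : (1 - s / t) * (pt1 i w).1 + s / t * (pt1 i w).2 + v ^+ 2 * s * (s - t) =
        ((y i w).1 - v * s * cos (th w)) ^+ 2 + ((y i w).2 - v * s * sin (th w)) ^+ 2.
      have st : s = s / t * t by rewrite divfK // gt_eqF.
      rewrite [in RHS]st [in X in _ + X = _]st /pt1 /sqdists /=; set q := s / t.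
      have cs : sin (th w) ^+ 2 = 1 - cos (th w) ^+ 2.
        by rewrite -(cos2Dsin2 (th w)); ring.
      transitivity (((y i w).1 - v * (q * t) * cos (th w)) ^+ 2 +
        ((y i w).2 - v * (q * t) * sin (th w)) ^+ 2 +
        v ^+ 2 * t ^+ 2 * q * (1 - q) * (cos (th w) ^+ 2 + sin (th w) ^+ 2 - 1)).
        by ring.
      by rewrite cos2Dsin2 subrr mulr0 addr0.
    apply: (no_handoverE _ t w _ _ (fun s => v ^+ 2 * s * (s - t)) t0).
    + by move=> i s; rewrite /= E addr_ge0 ?sqr_ge0.
    + by move=> i s; rewrite /= E.
    + exact: argmins_nonempty.
have c2 : (\sum_(0 <= k <oo) cell_value V n k @[n --> \oo] -->
    P2 (~` handover (dist_aer v h z ph) t))%E.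
  apply: (cvg_prob_argmins P2 pt2 mpt2) => //.
  - move=> n p q; have [r Hr] := rest_square (v * t) n p q.
    exact: (aerial_void lam0 (v * t) r (rest n p q) hlam
      (measurable_rest n p q) Hr P2 z ph aer).
  - move=> n p q; have [r Hr] := lowerset_square (v * t) n p q.
    exact: (aerial_void lam0 (v * t) r (lowerset n p q) hlam
      (measurable_lowerset n p q) Hr P2 z ph aer).
  - exact: measurableC.
  - move=> i w; exact: sq0.
  - apply: filterS (ae_count_finite P2 lam0 z hlam PPPz) => w Hw.
    have [lf1 lf2] := locally_finite_sqdists (v * t) z (fun i => ph i w) w Hw.
    split => //.
    (* The altitude only adds [h ^+ 2] to the term common to all stations. *)
    have E i s : (1 - s / t) * (pt2 i w).1 + s / t * (pt2 i w).2 +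
          (v ^+ 2 * s * (s - t) + h ^+ 2) =
        ((z i w).1 + v * s * cos (ph i w)) ^+ 2 +
        ((z i w).2 + v * s * sin (ph i w)) ^+ 2 + h ^+ 2.
      have st : s = s / t * t by rewrite divfK // gt_eqF.
      rewrite [in RHS]st [in X in _ + X = _]st /pt2 /sqdists /=; set q := s / t.
      transitivity (((z i w).1 + v * (q * t) * cos (ph i w)) ^+ 2 +
        ((z i w).2 + v * (q * t) * sin (ph i w)) ^+ 2 + h ^+ 2 +
        v ^+ 2 * t ^+ 2 * q * (1 - q) * (cos (ph i w) ^+ 2 + sin (ph i w) ^+ 2 - 1)).
        by ring.
      by rewrite cos2Dsin2 subrr mulr0 addr0.
    apply: (no_handoverE _ t w _ _ (fun s => v ^+ 2 * s * (s - t) + h ^+ 2) t0).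
    + by move=> i s; rewrite /= E !addr_ge0 ?sqr_ge0.
    + by move=> i s; rewrite /= E.
    + exact: argmins_nonempty.
have : P1 (~` handover (dist_terr v y th) t) = P2 (~` handover (dist_aer v h z ph) t).
  by apply: (cvg_unique _ c1 c2); exact: ereal_hausdorff.
have f1 : P1 (handover (dist_terr v y th) t) \is a fin_num by exact: fin_num_measure.
have f2 : P2 (handover (dist_aer v h z ph) t) \is a fin_num by exact: fin_num_measure.
rewrite !probability_setC // -(fineK f1) -(fineK f2) -!EFinB => -[].
by move=> /addrI /oppr_inj ->.
Qed.
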